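(* For every $\lambda>0$, $n\in\mathbb{N}_+$ and $t\ge 0$, the function $\mathcal{K}(t,n,\lambda)$ satisfies the recursive differential equation $$\frac{1}{\lambda}\frac{\partial\mathcal{K}(t,n,\lambda)}{\partial t}=-\sum_{j=1}^n F(j)\, \mathcal{K}(t,n,\lambda)+2\sum_{i=1}^{n-1}F(n-i)\,\mathcal{K}(t,i,\lambda)+\sum_{i=1}^n f(i)\,i\,(n+1-i)$$ with boundary condition $\mathcal{K}(0,n,\lambda)=0$. Moreover, $\mathcal{R}(t,n,\lambda) = n - \mathcal{K}(t,n,\lambda)$ satisfies the recursive differential equation $$\frac{1}{\lambda}\frac{\partial\mathcal{R}(t,n,\lambda)}{\partial t} = -\sum_{i=1}^n F(i)\, \mathcal{R}(t,n,\lambda ) + 2\sum_{i=1}^{n-1}F(n-i)\, \mathcal{R}(t,i,\lambda)$$ with boundary condition $\mathcal{R}(0,n,\lambda)=n$.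
   Context: Discrete sequential packing on a line. Fix $m\in\mathbb{N}_+$ and a probability distribution supported on $\{1,\dots,m\}$ (the bundle size distribution), with mass function $f(k)=P(B=k)$ and distribution function $F(k)=P(B\le k)$, where $B$ denotes a random variable with this distribution. There are $n$ packages at locations $1,\dots,n$ on a line, all available at time $0$. To each location $i$ is attached a Poisson process of rate $\lambda>0$; the processes at different locations are independent, and each point of each process carries a mark (bundle size); all marks are i.i.d. with distribution $F$ and independent of all the Poisson processes. A point of the process at location $i$ with mark $k$ is a request for the packages at locations $i,i+1,\dots,i+k-1$. The request is accepted if $i+k-1\le n$ and all these packages are still available at that time, in which case all $k$ of them are picked up (removed permanently); otherwise the request is rejected and nothing changes. $\mathcal{K}(t,n,\lambda)$ denotes the expected number of packages picked up during $[0,t]$. *)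

(* Defs.v *)
From HB Require Import structures.
From mathcomp Require Import all_boot all_order all_algebra finmap.
From mathcomp Require Import all_classical all_reals all_analysis.

Set Implicit Arguments.
Unset Strict Implicit.
Unset Printing Implicit Defensive.

Import Order.TTheory GRing.Theory Num.Theory.
Import numFieldNormedType.Exports.

Local Open Scope classical_set_scope.
Local Open Scope ring_scope.

Section bundle_size_distribution.
Context {R : realType}.
Implicit Type mu : probability nat R.

Definition bundle_pmf mu (k : nat) : R := fine (mu [set k]).

Definition bundle_cdf mu (k : nat) : R := fine (mu [set j | (j <= k)%N]).

End bundle_size_distribution.

Section independence.
Context d (Om : measurableType d) (R : realType) (P : probability Om R).

(* Mutual independence of a family (S i) of sigma-algebras. *)
Definition mutually_independent (I : eqType) (S : I -> set (set Om)) : Prop :=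
  forall (s : seq I) (A : I -> set Om),
    uniq s -> (forall i, i \in s -> S i (A i)) ->
    P (\big[setI/setT]_(i <- s) A i) = (\prod_(i <- s) P (A i))%E.

End independence.

Section poisson_process.
Context d (Om : measurableType d) (R : realType) (P : probability Om R).
Implicit Type T : nat -> {RV P >-> R}.

(* The points of the process are T 0 < T 1 < ...; [counting T s] is the number
   of points in [0, s].  The set below is almost surely finite; [fset_set] of
   an infinite set is the empty set. *)
Definition counting T (s : R) (w : Om) : nat :=
  #|` fset_set [set k | T k w <= s] |.

Definition counting_sigma_algebra T : set (set Om) :=
  <<s \bigcup_(s in [set s : R | 0 <= s])
        g_sigma_algebra_preimage (counting T s) >>.

Definition increment T (s t : R) (w : Om) : nat :=
  (counting T t w - counting T s w)%N.

Record poisson_process (lambda : R) T : Prop := PoissonProcess {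
  poisson_points : {ae P, forall w, [/\ 0 < T 0%N w,
    (forall k, T k w < T k.+1 w) & (forall s, exists k, s < T k w)]} ;
  poisson_increment_law : forall (s t : R) (c : nat), 0 <= s -> s < t ->
    P [set w | increment T s t w = c] = (poisson_pmf (lambda * (t - s)) c)%:E ;
  poisson_increment_indep : forall u : nat -> R, 0 <= u 0%N ->
    (forall l, u l <= u l.+1) ->
    mutually_independent P
      (fun l => g_sigma_algebra_preimage (increment T (u l) (u l.+1))) }.

End poisson_process.

(* Location i of the line 1, ..., n is represented by the ordinal i - 1 : 'I_n.
   The k-th point (k = 0, 1, ...) of the process at i is the time
   [arrival i k], and its mark is [mark i k]. *)
Record packing_model (R : realType) (mu : probability nat R) (lambda : R)
    (n : nat) := PackingModel {
  model_display : measure_display ;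
  model_space : measurableType model_display ;
  model_prob : probability model_space R ;
  arrival : 'I_n -> nat -> {RV model_prob >-> R} ;
  mark : 'I_n -> nat -> {RV model_prob >-> nat} ;
  arrival_poisson : forall i, poisson_process lambda (arrival i) ;
  mark_law : forall i k (A : set nat),
    distribution model_prob (mark i k) A = mu A ;
  model_indep : mutually_independent model_prob
    (fun x : 'I_n + 'I_n * nat =>
       match x with
       | inl i => counting_sigma_algebra (arrival i)
       | inr (i, k) => g_sigma_algebra_preimage (mark i k)
       end) }.

Section line.
Context {n : nat}.

Definition bundle (i : 'I_n) (b : nat) : {set 'I_n} :=
  [set j : 'I_n | (i <= j < i + b)%N].

(* A is the set of available packages.  As i is counted from 0, the condition
   i + b - 1 <= n on the last requested location reads i + b <= n here. *)
Definition serve (A : {set 'I_n}) (i : 'I_n) (b : nat) : {set 'I_n} :=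
  if (i + b <= n)%N && (bundle i b \subset A) then A :\: bundle i b else A.

End line.

Section packing.
Context {R : realType} {mu : probability nat R} {lambda : R} {n : nat}.
Variable M : packing_model mu lambda n.

Definition request_time (w : model_space M) (r : 'I_n * nat) : R :=
  arrival M r.1 r.2 w.

(* The requests made during [0, t], in chronological order.  Almost surely they
   are finitely many and no two of them are simultaneous. *)
Definition requests (t : R) (w : model_space M) : seq ('I_n * nat) :=
  sort (fun r1 r2 => request_time w r1 <= request_time w r2)
       (fset_set [set r | request_time w r <= t]).

Definition available (t : R) (w : model_space M) : {set 'I_n} :=
  foldl (fun A r => serve A r.1 (mark M r.1 r.2 w)) [set: 'I_n]%SET
        (requests t w).

Definition picked (t : R) (w : model_space M) : nat := #|~: available t w|.

Definition expected_picked (t : R) : R :=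
  fine ('E_(model_prob M)[fun w => (picked t w)%:R])%E.

Definition expected_remaining (t : R) : R := n%:R - expected_picked t.

End packing.

(* Derivative at t of a function of time on [0, +oo[: the usual derivative if
   t > 0, the right derivative if t = 0. *)
Definition time_derivative {R : realType} (g : R -> R) (t l : R) : Prop :=
  h^-1 * (g (t + h) - g t) @[h --> within [set h | 0 <= t + h] 0^'] --> l.

(* Main.v *)
Require Import Defs.
From HB Require Import structures.
From mathcomp Require Import all_boot all_order all_algebra finmap ring lra zify.
From mathcomp Require Import all_classical all_reals all_analysis.

(** The equation for the remaining packages reads R'(t, n) = lambda T R(t, .)(n),
    where T ([drift]) acts on sequences indexed by the length of the line.  The
    reason is that an accepted request cuts the maximal run that contains it into
    two shorter runs, which evolve independently of each other and in the same way
    as shorter lines.  The algebraic form of this remark is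
    [interval_sum_serve]: for a sequence a with a(0) = 0, let V_a(S) be the sum of
    a over the lengths of the maximal runs of the set S of available packages; then
    the expected change of V_a(S) caused by one request at a given location, summed
    over the locations, is V_(T a)(S).  For a(i) = i, V_a(S) is the number of
    packages in S.

    The models for lines of different lengths live on unrelated probability
    spaces, so the distributions have to be computed.  Cut [0, t] into slots and
    call history the list that tells, for each slot, whether no request or one
    request arrives in it, and in the latter case its location and its mark.  If a
    history occurs, it determines the available packages [occurs_available]; its
    probability is an explicit product, by the independence of increments,
    locations and marks [prob_occurs].  Summing over the histories, one slot of
    length h acts on sequences as the operator [slot_step]
    a |-> exp (- n lambda h) ((1 + n lambda h) a + lambda h T a),
    and the histories miss at most the sum of the (n lambda h)^2 in probability
    [history_sum1].  Hence the expected number of remaining packages is the value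
    at n of a product of such operators applied to the identity sequence, up to
    n times this probability [expected_remaining_enclosure].

    The slot operator agrees with the Euler step 1 + lambda h T, which is the same
    for all lengths of the line, up to O(h^2).  So, with N slots of length t / N, all
    the R(t, i) are approximated by one sequence (1 + lambda (t / N) T)^N id,
    with an error O(1 / N).  An additional slot of length k can be moved to the
    outside of the product, since all the operators are polynomials in T.  The
    limit N -> oo gives
    |R(t + k, n) - R(t, n) - k lambda T R(t, .)(n)| <= C k^2
    with C locally bounded in t [expected_remaining_step], which determines the
    derivatives on both sides [time_derivative_of_quadratic_error].  The equation
    for K = n - R follows by evaluating T at the identity sequence [drift_id]. *)

Set Implicit Arguments.
Unset Strict Implicit.
Unset Printing Implicit Defensive.

Import Order.TTheory GRing.Theory Num.Theory.
Import numFieldNormedType.Exports.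

Local Open Scope classical_set_scope.
Local Open Scope ring_scope.

(** * The bundle size distribution and the recursion operator *)

Section bundle_sizes.
Context {R : realType} {mu : probability nat R} {m : nat}.
Hypothesis hmu : mu [set k | (1 <= k <= m)%N] = 1%E.

Local Notation f := (bundle_pmf mu).
Local Notation F := (bundle_cdf mu).

Lemma bundle_pmf_ge0 k : 0 <= f k.
Proof. by rewrite fine_ge0. Qed.

Lemma bundle_pmf_out k : ~~ (1 <= k <= m)%N -> f k = 0.
Proof.
move=> hk; rewrite /bundle_pmf.
suff -> : mu [set k] = 0%E by [].
apply/eqP; rewrite eq_le measure_ge0 andbT.
have <- : mu (~` [set k | (1 <= k <= m)%N]) = 0%E.
  by rewrite probability_setC ?hmu ?subee.
by apply: le_measure; rewrite ?inE // => j /= ->; apply/negP.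
Qed.

Lemma bundle_cdf_sum j : F j = \sum_(1 <= k < j.+1) f k.
Proof.
elim: j => [|j IH].
  rewrite big_geq // -(@bundle_pmf_out 0%N) // /bundle_cdf /bundle_pmf.
  by congr (fine (mu _)); apply/seteqP; split => k /=; rewrite leqn0 => /eqP.
rewrite big_nat_recr //= -IH /bundle_cdf /bundle_pmf -fineD ?fin_num_measure //.
congr fine; rewrite -measureU //.
  congr (mu _); apply/seteqP; split => k /=.
    by rewrite leq_eqVlt => /orP[/eqP ->|]; [right|left].
  by move=> [/leqW|->].
by rewrite -subset0 => k /= [kj kE]; move: kj; rewrite kE ltnn.
Qed.

Lemma bundle_cdf_window j : F j = \sum_(1 <= k < m.+1 | (k <= j)%N) f k.
Proof.
rewrite bundle_cdf_sum; case: (leqP j m) => jm.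
  by rewrite (@big_nat_widen _ _ _ _ _ m.+1).
rewrite (@big_cat_nat _ _ _ m.+1) //=; last by rewrite ltnW.
rewrite [X in _ + X]big_nat_cond [X in _ + X]big1 ?addr0; last first.
  by move=> k /andP[/andP[mk _] _]; rewrite bundle_pmf_out //; lia.
rewrite big_nat_cond [RHS]big_nat_cond; apply: eq_bigl => k; lia.
Qed.

Lemma sum_bundle_pmf : \sum_(1 <= k < m.+1) f k = 1.
Proof.
rewrite -bundle_cdf_sum /bundle_cdf; suff -> : mu [set j | (j <= m)%N] = 1%E by [].
apply/eqP; rewrite eq_le probability_le1 //= -[X in (X <= _)%E]hmu.
by apply: le_measure; rewrite ?inE // => k /= /andP[].
Qed.

Lemma bundle_cdf_ge0 j : 0 <= F j. Proof. by rewrite fine_ge0. Qed.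

Lemma bundle_cdf_le1 j : F j <= 1.
Proof.
rewrite -sum_bundle_pmf bundle_cdf_window big_mkcond /=; apply: ler_sum => k _.
by case: ifP => // _; apply: bundle_pmf_ge0.
Qed.

End bundle_sizes.

(** The right-hand side of the equation for the remaining packages, without the
    factor lambda, as an operator on sequences indexed by the length of the line. *)
Definition drift {R : realType} (mu : probability nat R) (a : nat -> R) (L : nat) : R :=
  - (\sum_(1 <= j < L.+1) bundle_cdf mu j) * a L
  + 2 * \sum_(1 <= l < L) bundle_cdf mu (L - l)%N * a l.

Section drift.
Context {R : realType} {mu : probability nat R} {m : nat}.
Hypothesis hmu : mu [set k | (1 <= k <= m)%N] = 1%E.

(** A request for k packages at offset i of a run of length L splits it into runs
    of lengths i and L - i - k.  The left pieces contribute half of the convolution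
    with F, and the right pieces, after the reflection of the run, the other half. *)
Lemma drift_requests (a : nat -> R) (L : nat) : a 0%N = 0 ->
  \sum_(0 <= i < L) \sum_(1 <= k < m.+1) bundle_pmf mu k *
     (if (i + k <= L)%N then a i + a (L - i - k)%N - a L else 0) = drift mu a L.
Proof.
move=> a0; set f := bundle_pmf mu; pose F := bundle_cdf mu.
have left : \sum_(0 <= i < L) F (L - i)%N * a i =
            \sum_(1 <= l < L) F (L - l)%N * a l.
  case: L => [|L]; first by rewrite !big_geq.
  by rewrite big_nat_recl // a0 mulr0 add0r big_add1.
transitivity (\sum_(0 <= i < L) F (L - i)%N * a i
  + \sum_(0 <= i < L) \sum_(1 <= k < m.+1 | (i + k <= L)%N) f k * a (L - i - k)%N
  - \sum_(0 <= i < L) F (L - i)%N * a L).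
  rewrite -big_split -sumrB /=; apply: eq_big_nat => i /andP[_ iL].
  have E c : F (L - i)%N * c = \sum_(1 <= k < m.+1 | (i + k <= L)%N) f k * c.
    rewrite /F (bundle_cdf_window hmu) mulr_suml; apply: eq_bigl => k; lia.
  rewrite !E -big_split -sumrB /= [RHS]big_mkcond /=.
  by apply: eq_bigr => k _; case: ifP => _; rewrite ?mulr0 // -/f; ring.
rewrite left.
have -> : \sum_(0 <= i < L) F (L - i)%N * a L = (\sum_(1 <= j < L.+1) F j) * a L.
  rewrite -mulr_suml; congr (_ * _).
  rewrite big_add1 /= [RHS]big_nat_rev /=; apply: eq_big_nat => i /andP[_ iL].
  by congr F; lia.
have -> : \sum_(0 <= i < L) \sum_(1 <= k < m.+1 | (i + k <= L)%N)
            f k * a (L - i - k)%N = \sum_(1 <= l < L) F (L - l)%N * a l.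
  rewrite -left big_nat_rev /=.
  transitivity (\sum_(0 <= i < L) \sum_(1 <= k < m.+1 | (k <= i.+1)%N)
                  f k * a (i.+1 - k)%N).
    rewrite !big_nat; apply: eq_bigr => i /= iL.
    by apply: eq_big => [k|k _]; [lia|congr (_ * a _); lia].
  transitivity (\sum_(1 <= k < m.+1) \sum_(0 <= i < L | (k <= i.+1)%N)
                  f k * a (i.+1 - k)%N).
    rewrite (exchange_big_dep_nat xpredT) //=; apply: eq_bigr.
  transitivity (\sum_(1 <= k < m.+1) \sum_(0 <= i < L | (k <= L - i)%N)
                  f k * a i).
    rewrite !big_nat; apply: eq_bigr => k /andP[k0 _].
    rewrite (eq_bigl (fun i => true && (k.-1 <= i)%N)); last by move=> i /=; lia.
    rewrite -(big_nat_widenl _ 0) // -[in LHS](add0n k.-1) big_addn.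
    rewrite (big_nat_widen _ _ L); last by lia.
    rewrite big_nat_cond [RHS]big_nat_cond.
    by apply: eq_big => [i|i _]; [lia|congr (_ * a _); lia].
  rewrite (exchange_big_dep_nat xpredT) //=; apply: eq_bigr => i _.
  by rewrite /F (bundle_cdf_window hmu) mulr_suml.
by rewrite /drift -/F; ring.
Qed.

(** For the identity sequence, the split loses exactly the k packages picked, and
    n + 1 - k offsets are possible: this is the source term of the equation for
    the picked packages. *)
Lemma drift_id n :
  drift mu (fun i => i%:R) n =
  - \sum_(1 <= i < n.+1) bundle_pmf mu i * i%:R * (n + 1 - i)%:R.
Proof.
rewrite -drift_requests // exchange_big_nat /= -sumrN.
have term k : (1 <= k)%N ->
  \sum_(0 <= i < n) bundle_pmf mu k *
    (if (i + k <= n)%N then i%:R + (n - i - k)%:R - n%:R else 0) =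
  - (bundle_pmf mu k * k%:R * (n + 1 - k)%:R) :> R.
  move=> k1.
  rewrite (eq_bigr (fun i => if (i < n + 1 - k)%N then - (bundle_pmf mu k * k%:R)
                             else 0)); last first.
    move=> i _; rewrite (_ : (i < n + 1 - k)%N = (i + k <= n)%N); last by lia.
    case: ifP => ik; last by rewrite mulr0.
    have nE : n%:R = i%:R + (n - i - k)%:R + k%:R :> R.
      by rewrite -!natrD; congr (_%:R); lia.
    by rewrite nE; ring.
  rewrite -big_mkcond (eq_bigl (fun i => true && (i < n + 1 - k)%N)) //.
  rewrite -big_nat_widen; last by lia.
  by rewrite big_const_nat subn0 iter_addr_0 -[LHS]mulr_natr mulNr.
(* The bundle sizes are bounded by m and the accepted ones by n; both sums extend
   by zeros to the larger of the two bounds. *)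
have widen (G : nat -> R) a b : (a <= b)%N -> (forall k, (a < k)%N -> G k = 0) ->
    \sum_(1 <= k < a.+1) G k = \sum_(1 <= k < b.+1) G k.
  move=> ab G0; rewrite [RHS](big_cat_nat _ (n := a.+1)) //=.
  by rewrite [X in _ + X]big_nat [X in _ + X]big1 ?addr0 // => k /andP[/G0].
transitivity (\sum_(1 <= k < m.+1) - (bundle_pmf mu k * k%:R * (n + 1 - k)%:R) : R).
  by rewrite !big_nat; apply: eq_bigr => k /andP[k1 _]; exact: term.
rewrite (widen _ m (maxn m n)) ?leq_maxl // => [|k mk]; last first.
  by rewrite (bundle_pmf_out hmu) ?mul0r ?oppr0 //; lia.
rewrite -(widen _ n (maxn m n)) ?leq_maxr // => k nk.
by rewrite (_ : n + 1 - k = 0)%N ?mulr0 ?oppr0 //; lia.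
Qed.

End drift.

(** * The effect of one time slot on sequences *)

Lemma expRN_ge1Bx {R : realType} (x : R) : 1 - x <= expR (- x).
Proof. exact: expR_ge1Dx. Qed.

Lemma expRN_le1 {R : realType} (x : R) : 0 <= x -> expR (- x) <= 1.
Proof. by move=> x0; rewrite -[leRHS]expR0 ler_expR; lra. Qed.

Lemma expRN_1Dx_le1 {R : realType} (x : R) : expR (- x) * (1 + x) <= 1.
Proof.
rewrite expRN mulrC ler_pdivrMr ?expR_gt0 // mul1r; exact: expR_ge1Dx.
Qed.

(** With at most one request recorded per slot, exp (- x) (1 + x) is the
    probability that a slot with x expected requests is recorded faithfully. *)
Lemma expRN_1Dx_ge {R : realType} (x : R) :
  0 <= x -> 1 - x ^+ 2 <= expR (- x) * (1 + x).
Proof.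
move=> x0; have := ler_wpM2r (addr_ge0 ler01 x0) (expRN_ge1Bx x); rewrite expr2; lra.
Qed.

Section one_slot.
Context {R : realType} {mu : probability nat R} {m : nat}.
Hypothesis hmu : mu [set k | (1 <= k <= m)%N] = 1%E.

Lemma drift_comb x y (a b : nat -> R) L :
  drift mu (fun i => x * a i + y * b i) L = x * drift mu a L + y * drift mu b L.
Proof.
rewrite /drift.
under [X in _ + 2 * X]eq_bigr => i _ do
  rewrite mulrDr !(mulrCA (bundle_cdf mu _)).
by rewrite big_split /= -!mulr_sumr; ring.
Qed.

Lemma drift_ext (a b : nat -> R) L : (forall i, (i <= L)%N -> a i = b i) ->
  drift mu a L = drift mu b L.
Proof.
move=> ab; rewrite /drift ab //; congr (_ + 2 * _).
by apply: eq_big_nat => i /andP[_ /ltnW iL]; rewrite ab.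
Qed.

Lemma drift_bound (a : nat -> R) c L :
  (forall i, (i <= L)%N -> `|a i| <= c) -> `|drift mu a L| <= 3 * L%:R * c.
Proof.
move=> ac; have c0 : 0 <= c by exact: le_trans (normr_ge0 _) (ac 0%N _).
have F01 j : 0 <= bundle_cdf mu j <= 1 by rewrite bundle_cdf_ge0 (bundle_cdf_le1 hmu).
have hF : 0 <= \sum_(1 <= j < L.+1) bundle_cdf mu j <= L%:R.
  rewrite sumr_ge0 => [|i _]; last by case/andP: (F01 i).
  apply: le_trans (_ : \sum_(1 <= j < L.+1) 1 <= _) => //=.
    by apply: ler_sum => i _; case/andP: (F01 i).
  by rewrite big_const_nat subn1 iter_addr_0.
have hS : `|\sum_(1 <= l < L) bundle_cdf mu (L - l) * a l| <= L%:R * c.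
  apply: le_trans (ler_norm_sum _ _ _) _.
  apply: le_trans (_ : \sum_(1 <= l < L) c <= _).
    rewrite !big_nat; apply: ler_sum => l /andP[_ /ltnW lL].
    rewrite normrM; have /andP[? ?] := F01 (L - l)%N.
    by rewrite ger0_norm // -[leRHS]mul1r ler_pM // ac.
  rewrite big_const_nat iter_addr_0 -[leLHS]mulr_natl ler_wpM2r // ler_nat; lia.
rewrite /drift; apply: le_trans (ler_normD _ _) _.
rewrite !normrM normrN (ger0_norm (andP hF).1) normr_nat.
have := ler_pM (andP hF).1 (normr_ge0 _) (andP hF).2 (ac _ (leqnn L)).
lra.
Qed.

Variable lambda : R.
Hypothesis hlambda : 0 <= lambda.

(** The effect on sequences of a slot of length h in which at most one request
    arrives at the n locations.  The factor 1 + n lambda h comes from the case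
    without request and from the identity parts of the n possible requests. *)
Definition slot_step (n : nat) (h : R) (a : nat -> R) (i : nat) : R :=
  expR (- (n%:R * (lambda * h))) *
    ((1 + n%:R * (lambda * h)) * a i + lambda * h * drift mu a i).

Definition euler_step (h : R) (a : nat -> R) (i : nat) : R :=
  a i + lambda * h * drift mu a i.

(** All these operators are polynomials in the drift. *)
Lemma slot_step_comm n h h' a :
  slot_step n h (slot_step n h' a) = slot_step n h' (slot_step n h a).
Proof.
rewrite /slot_step; apply/funext => i.
set e := expR _; set e' := expR _; set x := _ * (_ * h); set x' := _ * (_ * h').
have E (u v w : R) : drift mu (fun j => u * (v * a j + w * drift mu a j)) i =
    u * (v * drift mu a i + w * drift mu (drift mu a) i).
  by rewrite -drift_comb -[RHS]addr0 -[X in _ + X](mul0r (drift mu a i))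
     -drift_comb; apply: drift_ext => j _; ring.
by rewrite !E; ring.
Qed.

Lemma iter_slot_step_comm n h h' a N :
  iter N (slot_step n h') (slot_step n h a) = slot_step n h (iter N (slot_step n h') a).
Proof. by elim: N => [//|N IH]; rewrite !iterS IH slot_step_comm. Qed.

Section bounds.
Variable n : nat.
Local Notation X := (n%:R * lambda).

Lemma request_rate_ge0 : 0 <= X. Proof. exact: mulr_ge0. Qed.

Lemma lambda_drift_bound (a : nat -> R) c i (h : R) : 0 <= h -> (i <= n)%N ->
  (forall j, (j <= n)%N -> `|a j| <= c) ->
  `|lambda * h * drift mu a i| <= 3 * X * h * c.
Proof.
move=> h0 iN ac; have c0 : 0 <= c by exact: le_trans (normr_ge0 _) (ac 0%N _).
have := @drift_bound a c i (fun j ji => ac j (leq_trans ji iN)).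
rewrite normrM (ger0_norm (mulr_ge0 _ _)) // => db.
apply: le_trans (ler_wpM2l (mulr_ge0 hlambda h0) db) _.
have iR : i%:R <= n%:R :> R by rewrite ler_nat.
have := ler_wpM2r (mulr_ge0 (mulr_ge0 hlambda h0) c0) iR; lra.
Qed.

Lemma euler_step_bound (a : nat -> R) c i (h : R) : 0 <= h -> (i <= n)%N ->
  (forall j, (j <= n)%N -> `|a j| <= c) ->
  `|euler_step h a i| <= (1 + 3 * X * h) * c.
Proof.
move=> h0 iN ac; apply: le_trans (ler_normD _ _) _.
have := lambda_drift_bound h0 iN ac; have := ac i iN; lra.
Qed.

Lemma slot_step_bound i0 (a : nat -> R) c i (h : R) : 0 <= h -> (i <= n)%N ->
  (forall j, (j <= n)%N -> `|a j| <= c) ->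
  `|slot_step i0 h a i| <= (1 + 3 * X * h) * c.
Proof.
move=> h0 iN ac; rewrite /slot_step; set x := i0%:R * _.
have x0 : 0 <= x by rewrite !mulr_ge0.
have := lambda_drift_bound h0 iN ac; set d := lambda * h * _ => hd.
rewrite mulrDr; apply: le_trans (ler_normD _ _) _.
rewrite mulrA !(normrM _ d) !(normrM _ (a i)) (ger0_norm (expR_ge0 _)).
rewrite ger0_norm; last by rewrite mulr_ge0 ?expR_ge0 // addr_ge0.
have := ler_wpM2r (normr_ge0 d) (expRN_le1 x0).
have := ler_wpM2r (normr_ge0 (a i)) (expRN_1Dx_le1 x); have := ac i iN; lra.
Qed.

(** The two operators have the same first-order expansion in h. *)
Lemma slot_step_euler i0 (a : nat -> R) c i (h : R) : 0 <= h ->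
  (i <= n)%N -> (i0 <= n)%N -> (forall j, (j <= n)%N -> `|a j| <= c) ->
  `|slot_step i0 h a i - euler_step h a i| <= 4 * (X * h) ^+ 2 * c.
Proof.
move=> h0 iN i0N ac; rewrite /slot_step /euler_step; set x := i0%:R * _.
have x0 : 0 <= x by rewrite !mulr_ge0.
have xX : x <= X * h.
  by rewrite /x -mulrA ler_wpM2r ?mulr_ge0 // ler_nat.
have := lambda_drift_bound h0 iN ac; set d := lambda * h * _ => hd.
have c0 : 0 <= c by exact: le_trans (normr_ge0 _) (ac 0%N _).
set e := expR (- x).
have -> : e * ((1 + x) * a i + d) - (a i + d) =
  (e * (1 + x) - 1) * a i + (e - 1) * d by ring.
apply: le_trans (ler_normD _ _) _; rewrite (normrM _ (a i)) (normrM _ d).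
have h1 : `|e * (1 + x) - 1| <= (X * h) ^+ 2.
  rewrite distrC ger0_norm ?subr_ge0 ?expRN_1Dx_le1 //.
  have := expRN_1Dx_ge x0; rewrite -/e.
  have : x ^+ 2 <= (X * h) ^+ 2 by rewrite ler_sqr ?nnegrE // (le_trans x0).
  lra.
have h2 : `|e - 1| <= X * h.
  rewrite distrC ger0_norm ?subr_ge0 ?expRN_le1 //.
  by have := expRN_ge1Bx x; rewrite -/e; lra.
have := ler_pM (normr_ge0 _) (normr_ge0 _) h1 (ac i iN).
have := ler_pM (normr_ge0 _) (normr_ge0 _) h2 hd.
have -> : X * h * (3 * X * h * c) = 3 * ((X * h) ^+ 2 * c) by ring.
lra.
Qed.

Lemma iter_euler_step_bound (a : nat -> R) c (h : R) N i : 0 <= h ->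
  (forall j, (j <= n)%N -> `|a j| <= c) -> (i <= n)%N ->
  `|iter N (euler_step h) a i| <= (1 + 3 * X * h) ^+ N * c.
Proof.
move=> h0 ac; elim: N i => [|N IH] i iN; first by rewrite expr0 mul1r ac.
by rewrite iterS exprS -mulrA; apply: euler_step_bound.
Qed.

Lemma slot_stepB i0 h (a b : nat -> R) i :
  slot_step i0 h (fun j => a j - b j) i = slot_step i0 h a i - slot_step i0 h b i.
Proof.
rewrite /slot_step (_ : drift mu _ i = drift mu a i - drift mu b i); first by ring.
transitivity (1 * drift mu a i + (-1) * drift mu b i); last by ring.
by rewrite -drift_comb; apply: drift_ext => j _; ring.
Qed.

(** The errors of the single steps add up, amplified by the norms of the other
    factors. *)
Lemma iter_slot_step_euler i0 (a : nat -> R) c (h : R) N i : 0 <= h ->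
  (forall j, (j <= n)%N -> `|a j| <= c) -> (i0 <= n)%N -> (i <= n)%N ->
  `|iter N (slot_step i0 h) a i - iter N (euler_step h) a i|
    <= N%:R * (4 * (X * h) ^+ 2 * ((1 + 3 * X * h) ^+ N * c)).
Proof.
move=> h0 ac i0N; have c0 : 0 <= c by exact: le_trans (normr_ge0 _) (ac 0%N _).
have X0 := request_rate_ge0.
elim: N i => [|N IH] i iN; first by rewrite subrr normr0 mul0r.
set b := iter N (slot_step i0 h) a; set y := iter N (euler_step h) a.
rewrite !iterS -/b -/y.
have -> : slot_step i0 h b i - euler_step h y i =
    slot_step i0 h (fun j => b j - y j) i + (slot_step i0 h y i - euler_step h y i).
  by rewrite slot_stepB; ring.
apply: le_trans (ler_normD _ _) _.
have := slot_step_bound i0 h0 iN IH.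
have := slot_step_euler h0 iN i0N (fun j jn => iter_euler_step_bound N h0 ac jn).
rewrite (exprS _ N) -[N.+1%:R]natr1; set p := (1 + 3 * X * h); set q := p ^+ N.
have q0 : 0 <= q by rewrite exprn_ge0 // addr_ge0 // !mulr_ge0.
have : q <= p * q.
  by rewrite -[leLHS]mul1r ler_wpM2r // /p lerDl !mulr_ge0.
move=> pq; have := ler_wpM2l (mulr_ge0 (sqr_ge0 (X * h)) c0) pq.
set s := (X * h) ^+ 2; lra.
Qed.

Lemma growth_factor (t : R) N : 0 <= t ->
  (1 + 3 * X * (t / N.+1%:R)) ^+ N.+1 <= expR (3 * X * t).
Proof.
move=> t0; have -> : 3 * X * t = 3 * X * (t / N.+1%:R) * N.+1%:R.
  by rewrite -!mulrA mulVf ?pnatr_eq0 // mulr1.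
rewrite expRM_natr; apply: lerXn2r; rewrite ?nnegrE ?expR_ge0 ?expR_ge1Dx //.
by rewrite addr_ge0 // !mulr_ge0 ?request_rate_ge0 ?invr_ge0.
Qed.

End bounds.
End one_slot.

Arguments slot_step {R} mu lambda n h a i.
Arguments euler_step {R} mu lambda h a i.

(** * Sums over the maximal runs of available packages *)

Section runs.
Context {R : realType}.
Implicit Types (a : nat -> R) (s : bitseq).

(** The accumulator L is the length of the run that ends just before s.  An empty
    run between two consecutive zeros contributes a(0), which is 0 in all uses. *)
Fixpoint run_sum a (L : nat) s : R :=
  match s with
  | [::] => a L
  | true :: s' => run_sum a L.+1 s'
  | false :: s' => a L + run_sum a 0 s'
  end.

(** The default value false of [nth] rejects the requests that leave the line. *)
Definition serve_bits s (i k : nat) : bitseq :=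
  if all (nth false s) (iota i k)
  then mkseq (fun j => nth false s j && ~~ (i <= j < i + k)%N) (size s)
  else s.

Lemma run_sum_ones a L i s : run_sum a L (nseq i true ++ s) = run_sum a (L + i) s.
Proof. by elim: i L => [|i IH] L /=; rewrite ?addn0 // IH addSnnS. Qed.

Lemma run_sum_zeros a L k s : a 0%N = 0 ->
  run_sum a L (nseq k.+1 false ++ s) = a L + run_sum a 0 s.
Proof.
move=> a0 /=; congr (_ + _).
by elim: k => [//|k IH] /=; rewrite a0 add0r.
Qed.

Lemma run_sum_cat a L s1 s2 :
  run_sum a L (s1 ++ false :: s2) = run_sum a L s1 + run_sum a 0 s2.
Proof. by elim: s1 L => [//|[] s1 IH] L /=; rewrite IH // addrA. Qed.

Lemma run_sum_ext a b L s : (forall i, (i <= L + size s)%N -> a i = b i) ->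
  run_sum a L s = run_sum b L s.
Proof.
elim: s L => [|[] s IH] L ab /=; first by rewrite ab ?addn0.
  by apply: IH => i iL; apply: ab; rewrite /= addnS -addSn.
by rewrite ab ?leq_addr // IH // => i; rewrite add0n => iL; apply: ab => /=; lia.
Qed.

Lemma run_sum_comb x y a b L s :
  run_sum (fun i => x * a i + y * b i) L s = x * run_sum a L s + y * run_sum b L s.
Proof. by elim: s L => [//|[] s IH] L /=; rewrite IH //; ring. Qed.

Lemma run_sum_id L s : run_sum (fun i => i%:R) L s = (L + count id s)%:R.
Proof.
elim: s L => [|[] s IH] L /=; first by rewrite addn0.
  by rewrite IH addSn addnS.
by rewrite IH add0n natrD.
Qed.

Lemma serve_bits_catl s1 s2 i k : (i < size s1)%N -> (0 < k)%N ->
  serve_bits (s1 ++ false :: s2) i k = serve_bits s1 i k ++ false :: s2.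
Proof.
move=> i1 k0; rewrite /serve_bits.
have -> : all (nth false (s1 ++ false :: s2)) (iota i k) =
          all (nth false s1) (iota i k).
  case: (leqP (i + k) (size s1)) => ik.
    apply: eq_in_all => j; rewrite mem_iota nth_cat => /andP[_ jk].
    by rewrite (leq_trans jk ik).
  transitivity false.
    apply/negbTE/allPn; exists (size s1); first by rewrite mem_iota; lia.
    by rewrite nth_cat ltnn subnn.
  apply/esym/negbTE/allPn; exists (size s1); first by rewrite mem_iota; lia.
  by rewrite nth_default.
case: allP => // h; have ik : (i + k <= size s1)%N.
  rewrite leqNgt; apply/negP => ik.
  have := h (size s1); rewrite nth_default // mem_iota.
  have -> : (i <= size s1 < i + k)%N by lia.
  by move=> /(_ isT).
apply: (@eq_from_nth _ false); first by rewrite !(size_mkseq, size_cat).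
move=> j; rewrite size_mkseq => js; rewrite nth_mkseq // !nth_cat size_mkseq.
case: ltnP => j1; first by rewrite nth_mkseq.
have -> : (i <= j < i + k)%N = false by lia.
by rewrite andbT.
Qed.

Lemma serve_bits_out s i k : (0 < k)%N -> nth false s i = false ->
  serve_bits s i k = s.
Proof. by case: k => // k _ /= si; rewrite /serve_bits /= si. Qed.

Lemma serve_bits_catr s1 s2 i k :
  serve_bits (s1 ++ false :: s2) (size s1 + i.+1) k =
  s1 ++ false :: serve_bits s2 i k.
Proof.
rewrite /serve_bits.
have -> : all (nth false (s1 ++ false :: s2)) (iota (size s1 + i.+1) k) =
          all (nth false s2) (iota i k).
  rewrite -[i.+1]addn1 addnA addnAC iotaDl all_map; apply: eq_all => j /=.
  rewrite nth_cat (_ : _ < _ = false)%N; last by lia.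
  by rewrite (_ : _ - _ = j.+1)%N; last by lia.
case: ifP => // _.
apply: (@eq_from_nth _ false).
  by rewrite size_mkseq !size_cat /= size_mkseq.
move=> j; rewrite size_mkseq => js; rewrite nth_mkseq // !nth_cat.
case: ltnP => j1; first by rewrite (_ : (_ <= _ < _)%N = false) ?andbT; lia.
case E : (j - size s1)%N => [//|j'] /=.
rewrite nth_mkseq; last by move: js; rewrite size_cat /=; lia.
congr (_ && ~~ _); lia.
Qed.

Lemma serve_bits_ones L i k : (i < L)%N -> (0 < k)%N ->
  serve_bits (nseq L true) i k =
  if (i + k <= L)%N then nseq i true ++ nseq k false ++ nseq (L - i - k) true
  else nseq L true.
Proof.
move=> iL k0; rewrite /serve_bits.
have -> : all (nth false (nseq L true)) (iota i k) = (i + k <= L)%N.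
  apply/allP/idP => [h|ik j].
    by have := h (i + k).-1; rewrite mem_iota nth_nseq; case: ifP; lia.
  by rewrite mem_iota nth_nseq; case: ifP => //; lia.
case: ifP => // ik; apply: (@eq_from_nth _ false).
  by rewrite size_mkseq !size_cat !size_nseq; lia.
move=> j; rewrite size_mkseq => js; rewrite nth_mkseq // !nth_cat !size_nseq.
rewrite size_nseq in js; rewrite !nth_nseq js /=.
case: (ltnP j i) => ji /=; first by [].
case: (ltnP j (i + k)) => jk /=; do 2 (case: ifP => ? /=); lia.
Qed.

End runs.

Section request_gain.
Context {R : realType} {mu : probability nat R} {m : nat}.
Hypothesis hmu : mu [set k | (1 <= k <= m)%N] = 1%E.
Implicit Types (a : nat -> R) (s : bitseq).

Definition gain a s : R :=
  \sum_(0 <= i < size s) \sum_(1 <= k < m.+1)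
    bundle_pmf mu k * (run_sum a 0 (serve_bits s i k) - run_sum a 0 s).

(** No accepted request crosses a package that is no longer available, so the
    parts of the line on its two sides contribute separately. *)
Lemma gain_cat a s1 s2 : gain a (s1 ++ false :: s2) = gain a s1 + gain a s2.
Proof.
rewrite /gain size_cat /=.
rewrite (@big_cat_nat _ _ _ (size s1)) ?leq_addr //=; congr (_ + _).
  apply: eq_big_nat => i /andP[_ i1]; apply: eq_big_nat => k /andP[k0 _].
  by rewrite serve_bits_catl // !run_sum_cat; congr (_ * _); ring.
rewrite -{1}[size s1]add0n big_addn addKn big_nat_recl //= big1_seq ?add0r.
  apply: eq_bigr => i _; apply: eq_bigr => k _.
  by rewrite addnC serve_bits_catr !run_sum_cat; congr (_ * _); ring.
move=> k; rewrite mem_index_iota => /andP[_ /andP[k0 _]].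
rewrite serve_bits_out ?subrr ?mulr0 //.
by rewrite nth_cat ltnn subnn.
Qed.

Lemma gain_ones a L : a 0%N = 0 -> gain a (nseq L true) = drift mu a L.
Proof.
move=> a0; rewrite -(drift_requests hmu _ a0) /gain size_nseq.
apply: eq_big_nat => i /andP[_ iL]; apply: eq_big_nat => k /andP[k0 _].
congr (_ * _); rewrite serve_bits_ones //; case: ifP => ik; last by rewrite subrr.
rewrite run_sum_ones add0n -(prednK k0) run_sum_zeros //.
by rewrite -[nseq (_ - _) _]cats0 -[X in _ - run_sum _ _ X]cats0 !run_sum_ones.
Qed.

(** The prefix of ones is the run that is being read; the induction moves bits of
    s to it until the first zero, where [gain_cat] separates it from the rest. *)
Lemma gain_runs a L s : a 0%N = 0 ->
  gain a (nseq L true ++ s) = run_sum (drift mu a) L s.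
Proof.
move=> a0; elim: s L => [|[] s IH] L /=.
- by rewrite cats0 gain_ones.
- by rewrite -IH; congr (gain a _); elim: L => //= L ->.
- by rewrite gain_cat gain_ones // -IH.
Qed.

Section on_sets.
Variable n : nat.
Implicit Type S : {set 'I_n}.

Definition bits S : bitseq := [seq i \in S | i <- enum 'I_n].

Definition interval_sum a S : R := run_sum a 0 (bits S).

Lemma size_bits S : size (bits S) = n.
Proof. by rewrite size_map size_enum_ord. Qed.

Lemma nth_bits S (i : 'I_n) : nth false (bits S) i = (i \in S).
Proof. by rewrite (nth_map i) ?size_enum_ord // nth_ord_enum. Qed.

Lemma bits_serve S (i : 'I_n) k : (0 < k)%N ->
  bits (serve S i k) = serve_bits (bits S) i k.
Proof.
move=> k0; rewrite /serve /serve_bits.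
have -> : (i + k <= n)%N && (bundle i k \subset S) =
    all (nth false (bits S)) (iota i k).
  apply/andP/allP => [[ik /fintype.subsetP h] j|h].
    rewrite mem_iota => ijk; have jn : (j < n)%N by lia.
    by rewrite -[j]/(val (Ordinal jn)) nth_bits; apply: h; rewrite inE.
  have ik : (i + k <= n)%N.
    rewrite leqNgt; apply/negP => ik; have := h n.
    rewrite nth_default ?size_bits // mem_iota.
    have -> : (i <= n < i + k)%N by have := ltn_ord i; lia.
    by move=> /(_ isT).
  split=> //; apply/fintype.subsetP => j; rewrite inE => ijk.
  by rewrite -nth_bits; apply: h; rewrite mem_iota.
case: ifP => // _; apply: (@eq_from_nth _ false).
  by rewrite size_mkseq !size_bits.
move=> j; rewrite size_bits => jn; rewrite nth_mkseq ?size_bits //.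
by rewrite -[j]/(val (Ordinal jn)) !nth_bits !inE andbC.
Qed.

Lemma interval_sum_full a : interval_sum a [set: 'I_n] = a n.
Proof.
rewrite /interval_sum (_ : bits _ = nseq n true ++ [::]).
  by rewrite run_sum_ones add0n.
rewrite cats0; apply: (@eq_from_nth _ false).
  by rewrite size_bits size_nseq.
move=> j; rewrite size_bits => jn.
by rewrite -[j]/(val (Ordinal jn)) nth_bits inE nth_nseq jn.
Qed.

Lemma interval_sum_card S : interval_sum (fun i => i%:R) S = #|S|%:R.
Proof.
rewrite /interval_sum run_sum_id add0n; congr (_%:R).
by rewrite count_map -size_filter cardE enumT; congr size.
Qed.

(** The identity behind the recursion: averaged over the requests, serving acts on
    sums over runs through the drift of the summed sequence. *)
Lemma interval_sum_serve a S : a 0%N = 0 ->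
  \sum_(i < n) \sum_(1 <= k < m.+1) bundle_pmf mu k * interval_sum a (serve S i k)
  = interval_sum (fun i => n%:R * a i + drift mu a i) S.
Proof.
move=> a0; have := gain_runs 0 (bits S) a0; rewrite /gain /= size_bits big_mkord.
move=> E; rewrite /interval_sum.
transitivity (n%:R * run_sum a 0 (bits S) + 1 * run_sum (drift mu a) 0 (bits S)).
  rewrite -E mul1r; set V := run_sum a 0 _.
  have -> : n%:R * V = \sum_(i < n) V by rewrite sumr_const card_ord mulr_natl.
  rewrite -big_split /=; apply: eq_bigr => i _.
  rewrite -[V in V + _]mul1r -(sum_bundle_pmf hmu) mulr_suml -big_split.
  apply: eq_big_nat => k /andP[k0 _].
  by rewrite /= bits_serve // -mulrDr addrC subrK.
by rewrite -run_sum_comb; apply: run_sum_ext => i _; rewrite mul1r.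
Qed.

End on_sets.
End request_gain.

(** * Paths of the process with a given history *)

Section counting_process.
Context d (Om : measurableType d) (R : realType) (P : probability Om R).
Implicit Type T : nat -> {RV P >-> R}.

(** The almost sure properties of the points of a Poisson process. *)
Definition regular_points T (w : Om) : Prop :=
  [/\ 0 < T 0%N w, (forall k, T k w < T k.+1 w) & (forall s, exists k, s < T k w)].

Lemma regular_points_mono T w : regular_points T w ->
  {homo (fun k => T k w) : i j / (i <= j)%N >-> i <= j}.
Proof.
by case=> _ Tlt _; apply: homo_leq => [//|x y z|k]; [exact: le_trans|exact/ltW].
Qed.

Lemma counting_le T w : regular_points T w ->
  forall s k, (T k w <= s) = (k < Defs.counting T s w)%N.
Proof.
move=> reg s; have [_ Tlt Tub] := reg.
case: (ex_minnP (Tub s)) => c sTc cmin.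
suff cE k : (T k w <= s) = (k < c)%N.
  move=> k; rewrite cE; congr (_ < _)%N; apply/esym/card_fset_set.
  by rewrite (_ : [set _ | _] = `I_c) //; apply/seteqP; split=> j /=; rewrite cE.
case: leqP => kc.
  by apply/negbTE; rewrite -ltNge (lt_le_trans sTc) // regular_points_mono.
rewrite leNgt; apply/negP => /cmin; lia.
Qed.

Lemma counting_mono T w s t : regular_points T w -> s <= t ->
  (Defs.counting T s w <= Defs.counting T t w)%N.
Proof.
move=> reg st; case E : (Defs.counting T s w) => [//|c].
by rewrite -counting_le // (le_trans _ st) // counting_le // E.
Qed.

Lemma counting0 T w : regular_points T w -> Defs.counting T 0 w = 0%N.
Proof.
move=> reg; have [T0 _ _] := reg; apply/eqP; rewrite -leqn0 leqNgt.
by rewrite -counting_le // -ltNge.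
Qed.

End counting_process.

Lemma pairwise_lt_inj {R : realType} (T : eqType) (g : T -> R) (s : seq T) :
  pairwise (fun x y => g x < g y) s -> {in s &, injective g}.
Proof.
elim: s => [//|z s IH] /= /andP[/allP zs /IH ginj] x y.
rewrite !inE => /predU1P[->|xs] /predU1P[->|ys] // gxy.
- by have := zs _ ys; rewrite gxy ltxx.
- by have := zs _ xs; rewrite gxy ltxx.
- exact: ginj.
Qed.

Section histories.
Context {n : nat}.

(** A history lists what arrives in the successive slots, the latest slot first:
    no request, or one request given by its location and its mark. *)
Notation history := (seq (option ('I_n * nat))).
Implicit Types (p : history) (o : option ('I_n * nat)).

Definition slot_count o (j : 'I_n) : nat :=
  if o is Some (i, _) then (i == j) else 0%N.

(** The rank of the next request at j, hence the index of its mark. *)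
Fixpoint rank p (j : 'I_n) : nat :=
  if p is o :: p' then (rank p' j + slot_count o j)%N else 0%N.

Fixpoint history_requests p : seq ('I_n * nat) :=
  match p with
  | [::] => [::]
  | None :: p' => history_requests p'
  | Some (i, _) :: p' => rcons (history_requests p') (i, rank p' i)
  end.

Fixpoint history_mark p (r : 'I_n * nat) : nat :=
  match p with
  | [::] => 0%N
  | None :: p' => history_mark p' r
  | Some (i, k) :: p' => if r == (i, rank p' i) then k else history_mark p' r
  end.

Fixpoint history_available p : {set 'I_n} :=
  match p with
  | [::] => [set: 'I_n]%SET
  | None :: p' => history_available p'
  | Some (i, k) :: p' => serve (history_available p') i k
  end.

Lemma mem_history_requests p j r :
  ((j, r) \in history_requests p) = (r < rank p j)%N.
Proof.
elim: p => [//|[[i k]|] p IH] /=; last by rewrite addn0.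
rewrite mem_rcons inE IH /= xpair_eqE (eq_sym j i).
case: (eqVneq i j) => [->|_] /=; last by rewrite addn0.
by rewrite addn1 ltnS [RHS]leq_eqVlt.
Qed.

Lemma uniq_history_requests p : uniq (history_requests p).
Proof.
elim: p => [//|[[i k]|] p IH] //=.
by rewrite rcons_uniq IH mem_history_requests ltnn.
Qed.

Lemma history_mark_cons p i k r : r \in history_requests p ->
  history_mark (Some (i, k) :: p) r = history_mark p r.
Proof.
by move=> rp /=; case: eqP => // rE; move: rp; rewrite rE mem_history_requests ltnn.
Qed.

End histories.

Local Notation history n := (seq (option ('I_n * nat))).

Section paths.
Context {R : realType} {mu : probability nat R} {lambda : R} {n : nat}.
Variable M : packing_model mu lambda n.
Variable u : nat -> R.
Hypotheses (u0 : u 0%N = 0) (umono : forall l, u l <= u l.+1).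

(** The boundaries of the slots are u 0 < u 1 < ..., and the head of a history
    o :: p' refers to the slot from u (size p') to u (size p').+1. *)
Fixpoint occurs (p : history n) (w : model_space M) : Prop :=
  match p with
  | [::] => True
  | o :: p' =>
    [/\ occurs p' w,
        forall j, increment (arrival M j) (u (size p')) (u (size p').+1) w
                  = slot_count o j &
        if o is Some (i, k) then mark M i (rank p' i) w = k else True]
  end.

Variable w : model_space M.
Hypothesis reg : forall j, regular_points (arrival M j) w.

Lemma occurs_counting p : occurs p w ->
  forall j, Defs.counting (arrival M j) (u (size p)) w = rank p j.
Proof.
elim: p => [_ j|o p IH [/IH cp inc _] j] /=; first by rewrite u0 counting0.
have := inc j; rewrite /increment cp => <-; rewrite subnKC // -cp.
exact: counting_mono.
Qed.

Lemma occurs_requests_le p : occurs p w ->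
  forall r, (request_time w r <= u (size p)) = (r \in history_requests p).
Proof.
move=> op [j r]; rewrite mem_history_requests /request_time /=.
by rewrite (counting_le (reg j)) occurs_counting.
Qed.

Lemma occurs_chronological p : occurs p w ->
  pairwise (fun r1 r2 => request_time w r1 < request_time w r2)
    (history_requests p).
Proof.
elim: p => [//|[[i k]|] p IH] //= [op _ _]; last exact: IH.
rewrite pairwise_rcons IH // andbT; apply/allP => r.
rewrite -occurs_requests_le // => ru.
apply: le_lt_trans ru _; rewrite ltNge occurs_requests_le //.
by rewrite mem_history_requests ltnn.
Qed.

(** On the event that the history occurs, no two requests are simultaneous because
    they lie in different slots, so the chronological sort has only one result. *)
Lemma occurs_requests p : occurs p w ->
  requests (u (size p)) w = history_requests p.
Proof.
move=> op; have ch := occurs_chronological op.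
have setE : [set r | request_time w r <= u (size p)] = [set` history_requests p].
  by apply/seteqP; split => r /=; rewrite occurs_requests_le.
have pe : perm_eq (fset_set [set` history_requests p]) (history_requests p).
  apply: uniq_perm; [exact: fset_uniq|exact: uniq_history_requests|move=> r].
  rewrite in_fset_set; last exact: finite_seq.
  by apply/idP/idP; rewrite inE.
rewrite /requests setE.
apply: (@sorted_eq_in _ (fun r1 r2 => request_time w r1 <= request_time w r2)).
- by move=> y x z _ _ _ /=; exact: le_trans.
- move=> x y; rewrite !(perm_mem (permEl (perm_sort _ _))) !(perm_mem pe).
  by move=> xp yp /le_anti; exact: (pairwise_lt_inj ch).
- by apply: sort_sorted => x y; apply: le_total.
- rewrite sorted_pairwise; last by move=> y x z /=; exact: le_trans.
  by apply: sub_pairwise ch => x y /ltW.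
- by rewrite perm_sort.
Qed.

Lemma occurs_available p : occurs p w ->
  available (u (size p)) w = history_available p.
Proof.
move=> op; rewrite /available occurs_requests //.
elim: p op => [//|[[i k]|] p IH] /= [op _ ik]; last exact: IH.
by rewrite foldl_rcons IH //= ik.
Qed.

End paths.

Arguments occurs {R mu lambda n} M u p w.

(** * Probabilities of histories *)

Section counting_measurability.
Context d (Om : measurableType d) (R : realType) (P : probability Om R).
Implicit Type T : nat -> {RV P >-> R}.

Lemma measurable_point_le T k s : measurable [set w | T k w <= s].
Proof.
rewrite (_ : [set w | _] = T k @^-1` `]-oo, s]); first exact: measurable_funPTI.
by apply/seteqP; split => w /=; rewrite in_itv.
Qed.

(** The counting process is 0 at the outcomes with infinitely many points before
    s, and elsewhere the set of these points ranges over countably many finite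
    sets. *)
Lemma measurable_counting T s c : measurable (Defs.counting T s @^-1` [set c]).
Proof.
pose E (X : {fset nat}) := [set w | [set k | T k w <= s] = [set` X]].
have mE X : measurable (E X).
  have -> : E X = \bigcap_k (if k \in X then [set w | T k w <= s]
                             else ~` [set w | T k w <= s]).
    apply/seteqP; split => w /=.
      move=> EX k _; have : [set k | T k w <= s] k <-> [set` X] k by rewrite EX.
      by move=> /=; case: ifP => _ [h1 h2]; [apply: h2|move=> /h1].
    move=> h; apply/seteqP; split => k /=; have := h k Logic.I; case: ifP => //.
  apply: bigcapT_measurable => k; case: ifP => _; last apply: measurableC.
    exact: measurable_point_le.
  exact: measurable_point_le.
have cX : countable [set: {fset nat}] by exact: countableP.
have -> : Defs.counting T s @^-1` [set c] =
    \bigcup_X (if #|` X| == c then E X else set0) `|`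
    (if c == 0%N then ~` \bigcup_X E X else set0).
  apply/seteqP; split => w /=.
    rewrite /Defs.counting; set A := [set k | _].
    have [fA|nfA] := pselect (finite_set A).
      move=> cA; left; exists (fset_set A) => //; rewrite cA eqxx /E /=.
      by rewrite -/A fset_setK.
    rewrite /fset_set; case: pselect => // _; rewrite cardfs0 => <-; right => /=.
    by case=> X _; rewrite /E /= => AX; apply: nfA; rewrite /A AX; exact: finite_fset.
  rewrite /Defs.counting => -[[X _]|].
    by case: eqP => // <-; rewrite /E /= => ->; rewrite set_fsetK.
  case: eqP => // -> h; rewrite /fset_set; case: pselect => [fA|_]; last exact: cardfs0.
  exfalso; apply: h; exists (fset_set [set k | T k w <= s]) => //.
  by rewrite /E /= fset_setK.
apply: measurableU; last first.
  case: ifP => // _; apply: measurableC; exact: countable_bigcupT_measurable.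
by apply: countable_bigcupT_measurable => // X; case: ifP.
Qed.

End counting_measurability.

(** Measurability of the increments is needed twice: in the probability space,
    and in the smaller sigma-algebra that the counting process generates. *)
Lemma measurable_subn_level d (X : measurableType d) (g h : X -> nat) c :
  (forall a, measurable (g @^-1` [set a])) ->
  (forall a, measurable (h @^-1` [set a])) ->
  measurable [set w | (h w - g w)%N = c].
Proof.
move=> mg mh.
rewrite (_ : [set w | _] = \bigcup_a \bigcup_b
    (if (b - a)%N == c then g @^-1` [set a] `&` h @^-1` [set b] else set0)).
  do 2 (apply: bigcupT_measurable => ?); case: ifP => // _; exact: measurableI.
apply/seteqP; split => w /=.
  by move=> <-; exists (g w) => //; exists (h w) => //; rewrite eqxx.
by move=> [a _ [b _]]; case: eqP => // <- [-> ->].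
Qed.

Section history_probability.
Context {R : realType} {mu : probability nat R} {lambda : R} {n : nat}.
Variable M : packing_model mu lambda n.
Variable u : nat -> R.
Implicit Type p : history n.
Notation P := (model_prob M).

Definition slot_weight (h : R) (o : option ('I_n * nat)) : R :=
  expR (- (n%:R * (lambda * h))) *
    (if o is Some (_, k) then lambda * h * bundle_pmf mu k else 1).

Fixpoint history_weight p : R :=
  if p is o :: p' then
    history_weight p' * slot_weight (u (size p').+1 - u (size p')) o
  else 1.

Definition history_slot p (l : nat) : option ('I_n * nat) := nth None (rev p) l.

Lemma history_slot_cons o p l : history_slot (o :: p) l =
  if (l < size p)%N then history_slot p l
  else if l == size p then o else None.
Proof. by rewrite /history_slot rev_cons nth_rcons size_rev. Qed.

(** The separation of the increments from the marks prepares the use of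
    independence: the first part involves each location separately, and the
    requests of the second part are pairwise distinct. *)
Lemma occurs_conj p w : occurs M u p w <->
  (forall l j, (l < size p)%N ->
     increment (arrival M j) (u l) (u l.+1) w = slot_count (history_slot p l) j) /\
  (forall r, r \in history_requests p -> mark M r.1 r.2 w = history_mark p r).
Proof.
elim: p => [|o p IH]; first by split.
split=> [[op inc om]|[inc om]].
  split.
    move=> l j /= lp; rewrite history_slot_cons; case: ltnP => lp'.
      exact: (IH.1 op).1.
    have -> : l = size p by lia.
    by rewrite eqxx inc.
  case: o {inc} om => [[i k]|] om r /=; last exact: (IH.1 op).2.
  rewrite mem_rcons inE; case: eqP => [->|] //= _; exact: (IH.1 op).2.
split.
- apply/IH; split=> [l j lp|r rp].
    by rewrite inc ?history_slot_cons ?lp //= ltnW.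
  case: o {inc} om => [[i k]|] om; last exact: om.
  by rewrite om ?history_mark_cons //= mem_rcons inE rp orbT.
- by move=> j; rewrite inc ?history_slot_cons //= ltnn eqxx.
- case: o {inc} om => [[i k]|] // om.
  by rewrite (om (i, rank p i)) /= ?eqxx // mem_rcons inE eqxx.
Qed.

Definition location_event p (j : 'I_n) : set (model_space M) :=
  \big[setI/setT]_(l <- iota 0 (size p))
    [set w | increment (arrival M j) (u l) (u l.+1) w =
             slot_count (history_slot p l) j].

Definition mark_event p (r : 'I_n * nat) : set (model_space M) :=
  mark M r.1 r.2 @^-1` [set history_mark p r].

Let coordinate_event p (x : 'I_n + 'I_n * nat) :=
  match x with inl j => location_event p j | inr r => mark_event p r end.

Let coordinates p : seq ('I_n + 'I_n * nat) :=
  map inl (enum 'I_n) ++ map inr (history_requests p).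

Lemma occurs_setE p : [set w | occurs M u p w] =
  \big[setI/setT]_(x <- coordinates p) coordinate_event p x.
Proof.
rewrite -bigcap_seq; apply/seteqP; split => w /=; rewrite occurs_conj.
  move=> [inc om] x /=; rewrite mem_cat => /orP[] /mapP[y yx ->] /=.
    rewrite /location_event -bigcap_seq => l /=; rewrite mem_iota => lp.
    exact: inc.
  exact: om.
move=> h; split=> [l j lp|r rp].
  have := h (inl j); rewrite /coordinates /= mem_cat map_f ?mem_enum // => /(_ isT).
  by rewrite /location_event -bigcap_seq => /(_ l); apply; rewrite /= mem_iota.
by have := h (inr r); rewrite /coordinates /= mem_cat map_f ?orbT // => /(_ isT).
Qed.

Lemma measurable_increment j s t c :
  measurable [set w | increment (arrival M j) s t w = c].
Proof.
by apply: measurable_subn_level => a; exact: measurable_counting.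
Qed.

Lemma measurable_occurs p : measurable [set w | occurs M u p w].
Proof.
rewrite occurs_setE; apply: bigsetI_measurable => -[j|r] _ /=.
  apply: bigsetI_measurable => l _; exact: measurable_increment.
exact: measurable_funPTI.
Qed.

Hypotheses (lambda_gt0 : 0 < lambda) (u0 : u 0%N = 0)
  (uinc : forall l, u l < u l.+1).

Lemma grid_time_ge0 l : 0 <= u l.
Proof.
by elim: l => [|l IH]; rewrite ?u0 // (le_trans IH) // ltW.
Qed.

Lemma counting_sigma_increment j l c :
  counting_sigma_algebra (arrival M j)
    [set w | increment (arrival M j) (u l) (u l.+1) w = c].
Proof.
rewrite /counting_sigma_algebra; set G := \bigcup_(s in _) _.
have mG l' a : <<s G >> (Defs.counting (arrival M j) (u l') @^-1` [set a]).
  apply: sub_sigma_algebra; exists (u l') => /=; first exact: grid_time_ge0.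
  by exists [set a] => //; rewrite setTI.
exact: (@measurable_subn_level _ (g_sigma_algebraType G)
  (Defs.counting (arrival M j) (u l)) (Defs.counting (arrival M j) (u l.+1))
  c (mG l) (mG l.+1)).
Qed.

Lemma location_event_sigma p j :
  counting_sigma_algebra (arrival M j) (location_event p j).
Proof.
rewrite /location_event.
apply: (@bigsetI_measurable _ (g_sigma_algebraType _)) => l _.
exact: counting_sigma_increment.
Qed.

Lemma prob_increment j l o :
  P [set w | increment (arrival M j) (u l) (u l.+1) w = slot_count o j] =
  (expR (- (lambda * (u l.+1 - u l))) *
   (lambda * (u l.+1 - u l)) ^+ slot_count o j)%:E.
Proof.
rewrite (poisson_increment_law (arrival_poisson M j)) ?grid_time_ge0 //.
rewrite /poisson_pmf mulr_gt0 ?subr_gt0 //; congr EFin; rewrite mulrC.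
by case: o => [[i k]|] /=; rewrite ?invr1 ?mulr1 //; case: (i == j);
  rewrite ?invr1 ?mulr1.
Qed.

Lemma prob_location_event p j : P (location_event p j) =
  (\prod_(l <- iota 0 (size p)) (expR (- (lambda * (u l.+1 - u l))) *
     (lambda * (u l.+1 - u l)) ^+ slot_count (history_slot p l) j))%:E.
Proof.
rewrite /location_event.
rewrite (poisson_increment_indep (arrival_poisson M j) (u := u)) ?u0 ?iota_uniq //.
- by rewrite -prodEFin; apply: eq_bigr => l _; rewrite prob_increment.
- by move=> l; rewrite ltW.
- move=> l _; exists [set slot_count (history_slot p l) j] => //; exact: setTI.
Qed.

Lemma prob_mark_event p r :
  P (mark_event p r) = (bundle_pmf mu (history_mark p r))%:E.
Proof.
rewrite fineK ?fin_num_measure //; case: r => i k.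
by rewrite -(mark_law M i k).
Qed.

(** At most one location has a request in the slot, so the n Poisson factors
    combine into one exponential and at most one power of lambda h. *)
Lemma prod_slot_count h o :
  (\prod_(j < n) (expR (- (lambda * h)) * (lambda * h) ^+ slot_count o j)) *
    (if o is Some (_, k) then bundle_pmf mu k else 1) = slot_weight h o.
Proof.
rewrite big_split /= prodr_const card_ord -expRM_natr mulNr [_ * n%:R]mulrC.
rewrite /slot_weight -mulrA; congr (_ * _).
case: o => [[i k]|] /=; last by rewrite mulr1 big1.
congr (_ * _); rewrite (bigD1 i) //= eqxx expr1 big1 ?mulr1 // => j ji.
by rewrite eq_sym (negbTE ji).
Qed.

(** Independence is used twice: between the locations and the marks here, and
    between the increments at one location in [prob_location_event]. *)
Lemma prob_occurs p : P [set w | occurs M u p w] = (history_weight p)%:E.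
Proof.
have uc : uniq (coordinates p).
  rewrite cat_uniq; apply/and3P; split.
  - by rewrite map_inj_uniq ?enum_uniq // => ? ? [].
  - by apply/hasPn => _ /mapP[r _ ->]; apply/mapP => -[].
  - by rewrite map_inj_uniq ?uniq_history_requests // => ? ? [].
rewrite occurs_setE (@model_indep _ _ _ _ M (coordinates p) (coordinate_event p) uc);
    last first.
  move=> [j|[i k]] _ /=; first exact: location_event_sigma.
  by exists [set history_mark p (i, k)] => //; rewrite setTI.
rewrite big_cat !big_map /=.
under eq_bigr do rewrite prob_location_event.
under [X in (_ * X)%E]eq_bigr do rewrite prob_mark_event.
rewrite !prodEFin -EFinM; congr EFin.
elim: p {uc} => [|o p IH]; rewrite [history_weight _]/=.
  by rewrite big_nil mulr1 big1 // => j _; rewrite big_nil.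
rewrite -{}IH -prod_slot_count.
rewrite (eq_bigr (fun j : 'I_n => (\prod_(l <- iota 0 (size p))
    (expR (- (lambda * (u l.+1 - u l))) *
     (lambda * (u l.+1 - u l)) ^+ slot_count (history_slot p l) j)) *
    (expR (- (lambda * (u (size p).+1 - u (size p)))) *
     (lambda * (u (size p).+1 - u (size p))) ^+ slot_count o j))); last first.
  move=> j _; rewrite [size _]/= -[X in iota _ X]addn1 iotaD big_cat big_seq1 add0n /=.
  rewrite history_slot_cons ltnn eqxx; congr (_ * _).
  rewrite !big_seq; apply: eq_bigr => l; rewrite mem_iota => /andP[_ lp].
  by rewrite history_slot_cons lp.
rewrite big_split [RHS]mulrACA; congr (_ * _).
case: o => [[i k]|]; last by rewrite mulr1.
rewrite [LHS]/= big_rcons /= eqxx; congr (_ * _).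
rewrite !big_seq; apply: eq_bigr => r rp; congr (bundle_pmf mu _).
exact: (history_mark_cons i k rp).
Qed.

End history_probability.

Arguments history_weight {R} mu lambda {n} u p.

(** * Enclosing an expectation by its values on disjoint events *)

Section expectation_bounds.
Context d (Om : measurableType d) (R : realType) (P : probability Om R).

(** The integral of a nonnegative function is the supremum over the simple
    functions below it, hence monotone even if the larger function is not
    measurable. *)
Lemma ge0_le_integralT (g h : Om -> \bar R) :
  (forall w, 0 <= g w)%E -> (forall w, g w <= h w)%E ->
  (\int[P]_w g w <= \int[P]_w h w)%E.
Proof.
move=> g0 gh; have h0 w : (0 <= h w)%E := le_trans (g0 w) (gh w).
rewrite !ge0_integralTE //; apply: le_ereal_sup => _ [k kg <-].
by exists k => // w; apply: le_trans (kg w) (gh w).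
Qed.

Lemma integral_step (I : Type) (s : seq I) (A : I -> set Om) (c : I -> R) :
  (forall i, measurable (A i)) -> (forall i, 0 <= c i) ->
  (\int[P]_w (\sum_(i <- s) c i * \1_(A i) w)%:E)%E =
  (\sum_(i <- s) c i * fine (P (A i)))%:E.
Proof.
move=> mA c0; under eq_integral do rewrite -sumEFin.
rewrite ge0_integral_sum //.
- rewrite -sumEFin; apply: eq_bigr => i _.
  under eq_integral do rewrite EFinM.
  rewrite ge0_integralZl_EFin //.
  + by rewrite integral_indic // setIT EFinM fineK // fin_num_measure.
  + apply/measurable_realfun.measurable_EFinP.
    exact: measurable_realfun.measurable_indic.
- move=> i; apply/measurable_realfun.measurable_EFinP.
  apply: measurable_realfun.measurable_funM => //.
- by move=> i w _; rewrite lee_fin mulr_ge0.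
Qed.

(** The function f may be non-measurable: it is enclosed between two step functions
    that differ only outside the events, by the bound b of f.  This serves for the
    number of packages picked, which is known only where the requests are regular
    and at most one of them arrives per slot. *)
Lemma expectation_on_events (I : choiceType) (s : seq I) (A : I -> set Om)
    (c : I -> R) (f : Om -> R) (b : R) :
  uniq s -> (forall i, measurable (A i)) -> (forall i, 0 <= c i) ->
  (forall i j w, i \in s -> j \in s -> A i w -> A j w -> i = j) ->
  (forall w, 0 <= f w <= b) ->
  (forall i w, i \in s -> A i w -> f w = c i) ->
  \sum_(i <- s) c i * fine (P (A i)) <= fine ('E_P[f])%E
    <= \sum_(i <- s) c i * fine (P (A i))
       + b * (1 - \sum_(i <- s) fine (P (A i))).
Proof.
move=> us mA c0 dA f0b fc.
have b0 : 0 <= b by have /andP[] := f0b point; exact: le_trans.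
(* The complement C completes the events to a partition, indexed by None. *)
pose C := ~` \big[setU/set0]_(i <- s) A i.
have mC : measurable C by apply: measurableC; exact: bigsetU_measurable.
pose B x := if x is Some i then A i else C.
have mB x : measurable (B x) by case: x.
pose step (c' : I -> R) (b' : R) w :=
  \sum_(x <- None :: map Some s) (if x is Some i then c' i else b') * \1_(B x) w.
have int_step c' b' : (forall i, 0 <= c' i) -> 0 <= b' ->
    (\int[P]_w (step c' b' w)%:E)%E =
    (\sum_(i <- s) c' i * fine (P (A i)) + b' * fine (P C))%:E.
  move=> c'0 b'0; rewrite integral_step //; last by case.
  by rewrite big_cons big_map addrC.
have step_in c' b' i w : i \in s -> A i w -> step c' b' w = c' i.
  move=> si Ai; rewrite /step big_cons big_map /= indicE memNset ?mulr0 ?add0r.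
    rewrite (bigD1_seq i) //= indicE mem_set // mulr1 big_seq_cond big1 ?addr0 //.
    move=> j /andP[sj ji]; rewrite indicE memNset ?mulr0 // => Aj.
    by move: ji; rewrite (dA _ _ _ si sj Ai Aj) eqxx.
  by apply; rewrite -bigcup_seq; exists i.
have step_out c' b' w : C w -> step c' b' w = b'.
  move=> Cw; rewrite /step big_cons big_map /= indicE mem_set // mulr1.
  rewrite big_seq big1 ?addr0 // => i si; rewrite indicE memNset ?mulr0 // => Ai.
  by apply: Cw; rewrite -bigcup_seq; exists i.
have cases w : (exists2 i, i \in s & A i w) \/ C w.
  have [|Cw] := pselect (C w); first by right.
  by left; move: Cw => /contrapT; rewrite -bigcup_seq => -[i]; exists i.
have PC : fine (P C) = 1 - \sum_(i <- s) fine (P (A i)).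
  have := int_step (fun=> 1) 1 (fun=> ler01) ler01.
  under eq_integral => w _.
    rewrite (_ : step _ _ w = 1); last by have [[i si Ai]|Cw] := cases w;
      [rewrite (step_in _ _ i)|rewrite step_out].
    over.
  rewrite integral_cst // => E.
  have E1 : 1%:E = (1%:E * P setT)%E by rewrite probability_setT mule1.
  have {E1 E} [] := etrans E1 E.
  by under eq_bigr do rewrite mul1r; move=> ->; ring.
have lo := int_step c 0 c0 (lexx 0); have up := int_step c b c0 b0.
rewrite mul0r addr0 in lo; rewrite PC in up.
have f0 w : 0 <= f w by have /andP[] := f0b w.
rewrite expectation.unlock.
have le_lo : (\int[P]_w (step c 0 w)%:E <= \int[P]_w (f w)%:E)%E.
  apply: ge0_le_integralT => w; rewrite lee_fin; have [[i si Ai]|Cw] := cases w.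
  - by rewrite (step_in _ _ i).
  - by rewrite step_out.
  - by rewrite (step_in _ _ i) // (fc i).
  - by rewrite step_out.
have le_up : (\int[P]_w (f w)%:E <= \int[P]_w (step c b w)%:E)%E.
  apply: ge0_le_integralT => w; rewrite lee_fin //; have [[i si Ai]|Cw] := cases w.
  - by rewrite (step_in _ _ i) // (fc i).
  - by rewrite step_out //; have /andP[] := f0b w.
move: le_lo le_up; rewrite lo up.
case: (\int[P]_w _)%E => [r| |] /=; last by [].
  by rewrite !lee_fin => h1 h2; apply/andP.
by move=> _; rewrite leye_eq.
Qed.

End expectation_bounds.

(** * Remaining packages at the end of a time grid *)

Section history_sums.
Context {R : realType} {mu : probability nat R} {m : nat}.
Hypothesis hmu : mu [set k | (1 <= k <= m)%N] = 1%E.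
Variables (lambda : R) (n : nat) (u : nat -> R).
Hypotheses (lambda_gt0 : 0 < lambda) (uinc : forall l, u l < u l.+1).

Definition symbols : seq (option ('I_n * nat)) :=
  None :: [seq Some (i, k) | i <- index_enum 'I_n, k <- index_iota 1 m.+1].

Fixpoint histories (N : nat) : seq (history n) :=
  if N is N'.+1 then [seq o :: p | p <- histories N', o <- symbols]
  else [:: [::]].

Lemma uniq_histories N : uniq (histories N).
Proof.
elim: N => [//|N IH].
apply: (@allpairs_uniq _ _ _ (fun (p : history n) o => o :: p)) => //.
  rewrite cons_uniq; apply/andP; split.
    by apply/allpairsP => -[[i k] /= [_ _]].
  apply: (@allpairs_uniq _ _ _ (fun i k => Some (i, k)));
    [exact: index_enum_uniq|exact: iota_uniq|].
  by move=> [i k] [j l] _ _ /= [-> ->].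
by move=> [p o] [q o'] _ _ /= [-> ->].
Qed.

Lemma size_history N p : p \in histories N -> size p = N.
Proof.
elim: N p => [|N IH] p; first by rewrite inE => /eqP ->.
by move=> /allpairsP[[q o] [/= qN _ ->]] /=; rewrite (IH q).
Qed.

Lemma sum_symbols (g : option ('I_n * nat) -> R) :
  \sum_(o <- symbols) g o =
  g None + \sum_(i < n) \sum_(1 <= k < m.+1) g (Some (i, k)).
Proof. by rewrite big_cons big_allpairs_dep. Qed.

Lemma sum_histories_S N (G : history n -> R) :
  \sum_(p <- histories N.+1) G p =
  \sum_(p <- histories N) \sum_(o <- symbols) G (o :: p).
Proof.
exact: (@big_allpairs_dep _ _ _ _ (fun=> option ('I_n * nat)) _ (fun p o => o :: p)).
Qed.

Local Notation weight := (history_weight mu lambda (n := n) u).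
Local Notation x_ l := (n%:R * (lambda * (u l.+1 - u l))).

Definition history_sum N (v : {set 'I_n} -> R) : R :=
  \sum_(p <- histories N) weight p * v (history_available p).

Lemma history_sumS N v : history_sum N.+1 v =
  history_sum N (fun S => expR (- x_ N) * (v S + lambda * (u N.+1 - u N) *
    \sum_(i < n) \sum_(1 <= k < m.+1) bundle_pmf mu k * v (serve S i k))).
Proof.
rewrite /history_sum sum_histories_S !big_seq; apply: eq_bigr => p pN.
rewrite sum_symbols /= (size_history pN) /slot_weight.
rewrite 2![in RHS]mulrDr; congr (_ + _); first by ring.
rewrite !mulr_sumr; apply: eq_bigr => i _.
rewrite !mulr_sumr; apply: eq_bigr => k _; ring.
Qed.

(** The last slot acts first on the sequence, as in the backward equation. *)
Fixpoint slot_steps (N : nat) (a : nat -> R) : nat -> R :=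
  if N is N'.+1 then slot_steps N' (slot_step mu lambda n (u N - u N') a) else a.

Lemma drift0 (a : nat -> R) : a 0%N = 0 -> drift mu a 0 = 0.
Proof. by move=> a0; rewrite /drift a0 mulr0 big_geq // mulr0 addr0. Qed.

(** The sum over the last slot of a history turns a sum over runs into the sum over
    runs of another sequence; the line without requests is a single run. *)
Lemma history_sum_intervals N (a : nat -> R) : a 0%N = 0 ->
  history_sum N (interval_sum a) = slot_steps N a n.
Proof.
elim: N a => [|N IH] a a0.
  by rewrite /history_sum /= big_seq1 mul1r interval_sum_full.
rewrite history_sumS /= -IH; last by rewrite /slot_step a0 drift0 // !mulr0 addr0 mulr0.
apply: eq_bigr => p _; congr (_ * _).
rewrite (interval_sum_serve hmu) //; set S := history_available p.
set h := u N.+1 - u N; set e := expR _.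
rewrite -[interval_sum a S]mul1r -run_sum_comb.
rewrite -[LHS]addr0 -[X in _ + X](mul0r (interval_sum a S)) -run_sum_comb.
apply: run_sum_ext => i _; rewrite /slot_step -/e; ring.
Qed.

Lemma history_weight_ge0 p : 0 <= weight p.
Proof.
elim: p => [|o p IH] //=; rewrite mulr_ge0 // /slot_weight mulr_ge0 ?expR_ge0 //.
case: o => [[i k]|] //; rewrite !mulr_ge0 ?bundle_pmf_ge0 ?subr_ge0 // ltW //.
Qed.

(** The histories have at most one request per slot, and a slot with x expected
    requests contains at least two with probability at most x^2. *)
Lemma history_sum1 N :
  1 - \sum_(l < N) (x_ l) ^+ 2 <= history_sum N (fun=> 1) <= 1.
Proof.
have W0 N' : 0 <= history_sum N' (fun=> 1).
  by apply: sumr_ge0 => p _; rewrite mulr1 history_weight_ge0.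
elim: N => [|N /andP[IH1 IH2]].
  by rewrite big_ord0 /history_sum /= big_seq1 mulr1 subr0 lexx.
have -> : history_sum N.+1 (fun=> 1) =
    expR (- x_ N) * (1 + x_ N) * history_sum N (fun=> 1).
  rewrite history_sumS /history_sum [RHS]mulr_sumr; apply: eq_bigr => p _.
  rewrite (eq_bigr (fun=> 1)); last first.
    by move=> i _; under eq_bigr do rewrite mulr1; rewrite (sum_bundle_pmf hmu).
  rewrite sumr_const card_ord; ring.
rewrite big_ord_recr /=; have x0 : 0 <= x_ N.
  by rewrite !mulr_ge0 ?subr_ge0 // ltW.
have := W0 N; set W := history_sum _ _ in IH1 IH2 * => W1.
have := ler_wpM2r W1 (expRN_1Dx_ge x0).
have := ler_wpM2r W1 (expRN_1Dx_le1 (x_ N)).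
have := ler_wpM2l (sqr_ge0 (x_ N)) IH2.
set y := x_ N ^+ 2; set z := expR _ * _; lra.
Qed.

End history_sums.

Arguments histories m n N : clear implicits.
Arguments slot_steps {R} mu lambda n u N a.
Arguments history_sum {R} mu m lambda n u N v.

Section remaining.
Context {R : realType} {mu : probability nat R} {m : nat}.
Hypothesis hmu : mu [set k | (1 <= k <= m)%N] = 1%E.
Variables (lambda : R) (n : nat) (u : nat -> R).
Hypotheses (lambda_gt0 : 0 < lambda) (u0 : u 0%N = 0) (uinc : forall l, u l < u l.+1).
Variable M : packing_model mu lambda n.

Lemma occurs_inj N (p q : history n) w :
  p \in histories m n N -> q \in histories m n N ->
  occurs M u p w -> occurs M u q w -> p = q.
Proof.
move=> /size_history + /size_history.
elim: p q N => [|o p IH] [|o' q] N /=; try by move=> <-.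
move=> <- [sz] [op inc om] [oq inc' om']; have pq := IH _ _ erefl sz op oq.
subst q; congr (_ :: _).
have cE j : slot_count o j = slot_count o' j by rewrite -inc inc'.
case: o o' cE om om' {inc inc'} => [[i k]|] [[i' k']|] //= cE.
- have := cE i; rewrite eqxx; case: (eqVneq i' i) => // -> _ <- <- //.
- by have := cE i; rewrite eqxx.
- by have := cE i'; rewrite eqxx.
Qed.

Lemma expected_remaining_enclosure N :
  slot_steps mu lambda n u N (fun i => i%:R) n <= expected_remaining M (u N)
   <= slot_steps mu lambda n u N (fun i => i%:R) n
      + n%:R * \sum_(l < N) (n%:R * (lambda * (u l.+1 - u l))) ^+ 2.
Proof.
have : {ae model_prob M, forall w, forall j, regular_points (arrival M j) w}.
  apply: filter_forall => j; exact: poisson_points (arrival_poisson M j).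
case=> Z [mZ PZ0 ZP].
have regw w : ~ Z w -> forall j, regular_points (arrival M j) w.
  by move=> nZ; apply: contrapT => nreg; apply: nZ; apply: ZP.
(* A null set is removed, as the path of a history is known for regular points. *)
pose A (p : history n) := [set w | occurs M u p w] `\` Z.
have PA p : fine (model_prob M (A p)) = history_weight mu lambda u p.
  have mo := measurable_occurs M u p; set O := [set w | _] in mo.
  have OZ : model_prob M (O `&` Z) = 0%E.
    apply/eqP; rewrite eq_le measure_ge0 andbT -[X in (_ <= X)%E]PZ0.
    by apply: le_measure; rewrite ?inE //; exact: measurableI.
  have E : model_prob M O = (model_prob M (A p) + model_prob M (O `&` Z))%E.
    exact: measureDI.
  by move: E; rewrite OZ adde0 (prob_occurs M lambda_gt0 u0 uinc p) => <-.
have cardb (S : {set 'I_n}) : (#|S| <= n)%N by rewrite -[leqRHS]card_ord max_card.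
pose c (p : history n) : R := #|~: history_available p|%:R.
have mA p : measurable (A p) by apply: measurableD => //; exact: measurable_occurs.
have c0 p : 0 <= c p by [].
have dA p q w : p \in histories m n N -> q \in histories m n N ->
    A p w -> A q w -> p = q.
  by move=> pN qN [op _] [oq _]; exact: occurs_inj pN qN op oq.
have picked_bound w : 0 <= ((picked (M := M) (u N) w)%:R : R) <= n%:R.
  by rewrite ler0n ler_nat cardb.
have picked_on p w : p \in histories m n N -> A p w -> (picked (u N) w)%:R = c p.
  move=> pN [op nZ]; rewrite /picked -(size_history pN).
  by rewrite (occurs_available u0 (fun l => ltW (uinc l)) (regw w nZ) op).
have /andP[] := @expectation_on_events _ _ R (model_prob M) _ _ A c
  (fun w => (picked (u N) w)%:R) n%:R (uniq_histories n N) mA c0 dA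
  picked_bound picked_on.
rewrite -/(expected_picked M (u N)) /c.
rewrite /expected_remaining.
under eq_bigr do rewrite PA; under [X in _ * (1 - X)]eq_bigr do rewrite PA.
have -> : \sum_(p <- histories m n N)
      #|~: history_available p|%:R * history_weight mu lambda u p
   = n%:R * history_sum mu m lambda n u N (fun=> 1)
     - history_sum mu m lambda n u N (interval_sum (fun i => i%:R)).
  rewrite /history_sum mulr_sumr -sumrB; apply: eq_bigr => p _.
  rewrite interval_sum_card -[in n%:R](card_ord n).
  by rewrite -(cardsC (history_available p)) natrD; ring.
rewrite (history_sum_intervals hmu) //.
have -> : \sum_(p <- histories m n N) history_weight mu lambda u p =
    history_sum mu m lambda n u N (fun=> 1).
  by apply: eq_bigr => p _; rewrite mulr1.
have := history_sum1 hmu n lambda_gt0 uinc N.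
have n0 : 0 <= n%:R :> R by [].
set W := history_sum _ _ _ _ _ _ _; set E := expected_picked _ _.
set x := \sum_(l < N) _.
move=> /andP[W1 W2] E1 E2.
have := ler_wpM2l n0 W1; have := ler_wpM2l n0 W2; lra.
Qed.

End remaining.

(** * Refining the grid *)

Lemma expected_remaining_bound {R : realType} (mu : probability nat R) lambda n
    (M : packing_model mu lambda n) t :
  0 <= expected_remaining M t <= n%:R.
Proof.
have bnd w : 0 <= ((picked (M := M) t w)%:R : R) <= n%:R.
  by rewrite ler0n ler_nat -[leqRHS]card_ord max_card.
have := @expectation_on_events _ _ R (model_prob M) nat [::] (fun=> set0)
  (fun=> 0) (fun w => (picked t w)%:R) n%:R isT (fun=> measurable0) (fun=> lexx 0).
rewrite !big_nil add0r subr0 mulr1 => /(_ _ bnd _) /andP[] //.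
by rewrite /expected_remaining -/(expected_picked M t) => E0 En; lra.
Qed.

Lemma le_of_inv_nat {R : realType} (A K B : R) :
  (forall N, A <= K / N.+1%:R + B) -> A <= B.
Proof.
move=> h; rewrite leNgt; apply/negP => BA; have AB : 0 < A - B by rewrite subr_gt0.
have K0 : 0 <= `|K| / (A - B) by rewrite divr_ge0 // ltW.
have := archi_boundP K0; set N := Num.bound _ => hN.
have N0 : 0 < N.+1%:R :> R by [].
have := h N; rewrite -lerBlDr ler_pdivlMr //.
have : `|K| < (A - B) * N.+1%:R.
  rewrite mulrC -ltr_pdivrMr //; apply: lt_trans hN _; by rewrite ltr_nat.
have := ler_norm K; lra.
Qed.

(** The forward estimate at t gives the right derivative.  The left derivative comes
    from the forward estimates at the times s < t, which hold with the same constant,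
    and from the continuity of D. *)
Lemma time_derivative_of_quadratic_error {R : realType} (g D : R -> R) (t C L : R) :
  0 <= t -> 0 <= C -> 0 <= L ->
  (forall s k, 0 <= s <= t -> 0 < k -> `|g (s + k) - g s - k * D s| <= C * k ^+ 2) ->
  (forall s, 0 <= s <= t -> `|D s - D t| <= L * (t - s)) ->
  time_derivative g t (D t).
Proof.
move=> t0 C0 L0 gD DL; rewrite /time_derivative.
apply/cvgrPdist_le => e e0; rewrite near_withinE near_withinE.
have d0 : 0 < e / (C + L + 1) by rewrite divr_gt0 // ltr_wpDl // addr_ge0.
apply/nbhs_ballP; exists (e / (C + L + 1)) => //= h.
rewrite /ball /= sub0r normrN ltr_pdivlMr; last by rewrite ltr_wpDl // addr_ge0.
move=> he h0 th.
have key k : 0 < k -> `|k * (h^-1 * (g (t + h) - g t) - D t)| <= (C + L) * k ^+ 2 ->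
    k = `|h| -> `|D t - h^-1 * (g (t + h) - g t)| <= e.
  move=> k0; rewrite distrC normrM (gtr0_norm k0) expr2 mulrCA ler_pM2l // => hk kE.
  apply: le_trans hk _; have := normr_ge0 h; rewrite kE; lra.
case: (ltgtP h 0) => h0'; last by rewrite h0' eqxx in h0.
- apply: (key (- h)); rewrite ?oppr_gt0 ?(ltr0_norm h0') //.
  have st : 0 <= t + h <= t by rewrite th; lra.
  have := gD (t + h) (- h) st; rewrite oppr_gt0 => /(_ h0').
  have -> : t + h - h = t by ring.
  have := DL _ st; have -> : t - (t + h) = - h by ring.
  move=> hD hg.
  have -> : - h * (h^-1 * (g (t + h) - g t) - D t) =
      (g t - g (t + h) - (- h) * D (t + h)) + (- h) * (D (t + h) - D t).
    by field.
  apply: le_trans (ler_normD _ _) _.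
  rewrite (normrM (- h)) (gtr0_norm (_ : 0 < - h)) ?oppr_gt0 //.
  have nh : 0 <= - h by lra.
  have := ler_wpM2l nh hD; rewrite !expr2 in hg *; lra.
- apply: (key h); rewrite ?(gtr0_norm h0') //.
  have := gD t h; rewrite t0 lexx => /(_ isT h0') hg.
  have -> : h * (h^-1 * (g (t + h) - g t) - D t) = g (t + h) - g t - h * D t.
    by field; rewrite gt_eqF.
  by apply: le_trans hg _; rewrite ler_wpM2r ?sqr_ge0 // lerDl.
Qed.

(** At a fixed time, the sequence on which the drift acts. *)
Definition mean_remaining {R : realType} {mu : probability nat R} {lambda : R}
    (M : forall n, packing_model mu lambda n) (t : R) (i : nat) : R :=
  expected_remaining (M i) t.

Section grid.
Context {R : realType} {mu : probability nat R} {m : nat}.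
Hypothesis hmu : mu [set k | (1 <= k <= m)%N] = 1%E.
Variable lambda : R.
Hypothesis lambda_gt0 : 0 < lambda.
Local Notation slot_step := (slot_step mu lambda).
Local Notation euler_step := (euler_step mu lambda).

(** The boundaries of N slots of length h, followed by slots of length k. *)
Definition grid (N : nat) (h k : R) (l : nat) : R :=
  (minn l N)%:R * h + (l - N)%:R * k.

Lemma grid_step N h k l :
  grid N h k l.+1 - grid N h k l = if (l < N)%N then h else k.
Proof.
rewrite /grid; case: ltnP => lN.
  rewrite (minn_idPl lN).
  rewrite (eqP (_ : l.+1 - N == 0)%N) ?subn_eq0 //.
  by rewrite (eqP (_ : l - N == 0)%N) ?subn_eq0 ?(ltnW lN) // -natr1; ring.
rewrite (minn_idPr (leqW lN)) subSn // -natr1; ring.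
Qed.

Lemma slot_steps_grid n N h k a :
  slot_steps mu lambda n (grid N h k) N a = iter N (slot_step n h) a.
Proof.
suff H N' : (N' <= N)%N ->
    slot_steps mu lambda n (grid N h k) N' a = iter N' (slot_step n h) a by exact: H.
elim: N' a => [//|N' IH] a N'N.
by rewrite iterSr -IH ?(ltnW N'N) //= grid_step N'N.
Qed.

Section model.
Variables (n : nat) (M : packing_model mu lambda n).
Let id_ (i : nat) : R := i%:R.

(** The last slot of length k is the innermost operator in the second product. *)
Lemma expected_remaining_grid N h k : 0 < h -> 0 < k ->
  `|expected_remaining M (N%:R * h) - iter N (slot_step n h) id_ n|
    <= n%:R * (N%:R * (n%:R * lambda * h) ^+ 2)
  /\ `|expected_remaining M (N%:R * h + k) -
       iter N (slot_step n h) (slot_step n k id_) n|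
    <= n%:R * (N%:R * (n%:R * lambda * h) ^+ 2 + (n%:R * lambda * k) ^+ 2).
Proof.
move=> h0 k0; pose u := grid N h k.
have u0 : u 0%N = 0 by rewrite /u /grid min0n sub0n !mul0r addr0.
have uinc l : u l < u l.+1.
  by rewrite -subr_gt0 grid_step; case: ifP.
have sumN : \sum_(l < N) (n%:R * (lambda * (u l.+1 - u l))) ^+ 2 =
    N%:R * (n%:R * lambda * h) ^+ 2.
  rewrite (eq_bigr (fun=> (n%:R * lambda * h) ^+ 2)) => [|l _].
    by rewrite sumr_const card_ord -[LHS]mulr_natl.
  by rewrite grid_step ltn_ord mulrA.
split.
  have := expected_remaining_enclosure hmu lambda_gt0 u0 uinc M N.
  rewrite sumN slot_steps_grid /u /grid minnn subnn mul0r addr0 -/id_ => /andP[h1 h2].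
  by rewrite ger0_norm; lra.
have := expected_remaining_enclosure hmu lambda_gt0 u0 uinc M N.+1.
rewrite big_ord_recr /= sumN grid_step ltnn slot_steps_grid.
rewrite {1 2}/u /grid (minn_idPr (leqnSn N)) subSnn mul1r -/id_ => /andP[h1 h2].
by rewrite ger0_norm; rewrite ?mulrA in h1 h2 *; lra.
Qed.

End model.

Variable M : forall n, packing_model mu lambda n.
Local Notation Rem := (mean_remaining M).

Lemma expected_remaining0 n : Rem 0 n = n%:R.
Proof.
have [] := @expected_remaining_grid n (M n) 0 1 1 ltr01 ltr01.
by rewrite !mul0r mulr0 normr_le0 subr_eq0 => /eqP.
Qed.

Section error.
Variable n : nat.
Local Notation X := (n%:R * lambda).

Lemma request_rate_sqr_le i (k : R) : 0 <= k -> (i <= n)%N ->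
  (i%:R * lambda * k) ^+ 2 <= (X * k) ^+ 2.
Proof.
move=> k0 iN; have l0 := ltW lambda_gt0; rewrite ler_sqr ?nnegrE ?mulr_ge0 //.
apply: ler_wpM2r => //; apply: ler_wpM2r; rewrite ?ler_nat //; exact: ltW.
Qed.

Lemma quadratic_error_le i N (h k : R) : 0 <= h -> 0 <= k -> (i <= n)%N ->
  i%:R * (N%:R * (i%:R * lambda * h) ^+ 2 + (i%:R * lambda * k) ^+ 2) <=
  n%:R * (N%:R * (X * h) ^+ 2 + (X * k) ^+ 2).
Proof.
move=> h0 k0 iN; apply: ler_pM => //.
- by apply: addr_ge0; [apply: mulr_ge0 => //|]; exact: sqr_ge0.
- by rewrite ler_nat.
- by rewrite lerD ?request_rate_sqr_le // ler_wpM2l ?request_rate_sqr_le.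
Qed.

Lemma euler_step_ext (k : R) (a b : nat -> R) i : (forall j, (j <= i)%N -> a j = b j) ->
  euler_step k a i = euler_step k b i.
Proof. by move=> ab; rewrite /euler_step (drift_ext ab) ab. Qed.

Lemma euler_stepB k (a b : nat -> R) i :
  euler_step k (fun j => a j - b j) i = euler_step k a i - euler_step k b i.
Proof.
rewrite /euler_step (_ : drift mu _ i = drift mu a i - drift mu b i); first by ring.
transitivity (1 * drift mu a i + (-1) * drift mu b i); last by ring.
by rewrite -drift_comb; apply: drift_ext => j _; ring.
Qed.

(** The forward estimate.  The sequence y of Euler steps approximates the expected
    numbers of remaining packages for all lengths j <= n at once, although they
    come from different models. *)
Lemma expected_remaining_step (t k : R) i : 0 <= t -> 0 < k -> (i <= n)%N ->
  `|Rem (t + k) i - euler_step k (Rem t) i|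
    <= n%:R * X ^+ 2 * (1 + 4 * expR (3 * X * t)) * k ^+ 2.
Proof.
move=> t0 k0 iN; have lambda0 := ltW lambda_gt0; have k0' := ltW k0.
have X0 : 0 <= X by rewrite mulr_ge0.
pose id_ (j : nat) : R := j%:R.
have id_n j : (j <= n)%N -> `|id_ j| <= n%:R.
  by move=> jn; rewrite ger0_norm // ler_nat.
(* At t = 0 the grid would have slots of length 0; a single slot suffices. *)
move: t0; rewrite le_eqVlt => /predU1P[<-|t0].
  have [_] := expected_remaining_grid (M i) 0 ltr01 k0.
  rewrite mul0r => h1.
  have h2 := slot_step_euler hmu lambda0 k0' iN iN id_n.
  have h3 := quadratic_error_le 0 ler01 k0' iN.
  rewrite (@euler_step_ext _ _ id_) => [|j _]; last exact: expected_remaining0.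
  rewrite mulr0 expR0 -[_ - _](subrKA (slot_step i k id_ i)).
  apply: le_trans (ler_normD _ _) _.
  apply: le_trans (lerD (le_trans h1 h3) h2) _.
  by rewrite le_eqVlt; apply/orP; left; apply/eqP; ring.
pose Y := expR (3 * X * t); rewrite -/Y.
(* E / N.+1 bounds the two errors of the grid: the histories missed, and the
   replacement of slot operators by Euler steps. *)
pose E : R := n%:R * (X * t) ^+ 2 * (1 + 4 * Y).
apply: (@le_of_inv_nat _ _ ((3 + 6 * X * k) * E)) => N.
pose h := t / N.+1%:R.
have h0 : 0 < h by rewrite divr_gt0.
have h0' := ltW h0.
have N0 : N.+1%:R != 0 :> R by rewrite pnatr_eq0.
have tE : N.+1%:R * h = t by rewrite mulrC divfK.
have NhE : N.+1%:R * (X * h) ^+ 2 = (X * t) ^+ 2 / N.+1%:R.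
  by rewrite /h; field.
pose y := iter N.+1 (euler_step h) id_.
pose b j := iter N.+1 (slot_step j h) id_.
have yY j : (j <= n)%N -> `|y j| <= Y * n%:R.
  move=> jn; apply: le_trans (iter_euler_step_bound hmu lambda0 N.+1 h0' id_n jn) _.
  by rewrite ler_wpM2r // growth_factor // ltW.
have by_ j i0 : (j <= n)%N -> (i0 <= n)%N ->
    `|b i0 j - y j| <= n%:R * (X * t) ^+ 2 * (4 * Y) / N.+1%:R.
  move=> jn i0n.
  apply: le_trans (iter_slot_step_euler hmu lambda0 N.+1 h0' id_n i0n jn) _.
  have -> : n%:R * (X * t) ^+ 2 * (4 * Y) / N.+1%:R =
     N.+1%:R * (4 * (X * h) ^+ 2 * (Y * n%:R)).
    by rewrite /h; field.
  apply: ler_wpM2l => //; apply: ler_wpM2l; first by rewrite mulr_ge0 ?sqr_ge0.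
  apply: ler_wpM2r => //.
  exact: growth_factor (ltW t0).
have remb j : (j <= n)%N -> `|Rem t j - b j j| <= n%:R * (X * t) ^+ 2 / N.+1%:R.
  move=> jn; have [+ _] := expected_remaining_grid (M j) N.+1 h0 k0.
  rewrite tE => /le_trans; apply.
  have := quadratic_error_le N.+1 h0' (lexx 0) jn.
  by rewrite !mulr0 expr0n /= !addr0 NhE [X in _ <= X -> _]mulrA.
have remy j : (j <= n)%N -> `|Rem t j - y j| <= E / N.+1%:R.
  move=> jn; rewrite -(subrKA (b j j)); apply: le_trans (ler_normD _ _) _.
  apply: le_trans (lerD (remb _ jn) (by_ _ _ jn jn)) _.
  by rewrite -mulrDl /E; rewrite le_eqVlt; apply/orP; left; apply/eqP; field.
have byE j i0 : (j <= n)%N -> (i0 <= n)%N -> `|b i0 j - y j| <= E / N.+1%:R.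
  move=> jn i0n; apply: le_trans (by_ _ _ jn i0n) _.
  rewrite ler_wpM2r ?invr_ge0 // /E mulrDr mulr1 lerDr.
  by rewrite mulr_ge0 // sqr_ge0.
have s1 : `|Rem (t + k) i - slot_step i k (b i) i| <=
    E / N.+1%:R + n%:R * (X * k) ^+ 2.
  have [_] := expected_remaining_grid (M i) N.+1 h0 k0.
  (* Commutation brings the operator of the additional slot to the front. *)
  rewrite tE iter_slot_step_comm => /le_trans; apply.
  apply: le_trans (quadratic_error_le N.+1 h0' k0' iN) _.
  rewrite mulrDr lerD2r NhE mulrA ler_wpM2r ?invr_ge0 // /E.
  rewrite mulrDr mulr1 lerDl; apply: mulr_ge0; last by rewrite mulr_ge0 ?expR_ge0.
  by apply: mulr_ge0 => //; exact: sqr_ge0.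
have s2 : `|slot_step i k (b i) i - slot_step i k y i| <=
    (1 + 3 * X * k) * (E / N.+1%:R).
  rewrite -slot_stepB; apply: (slot_step_bound hmu lambda0 (n := n)) => // j jn.
  exact: byE.
have s3 : `|slot_step i k y i - euler_step k y i| <= 4 * (X * k) ^+ 2 * (Y * n%:R).
  exact: (slot_step_euler hmu lambda0 (n := n)).
have s4 : `|euler_step k (Rem t) i - euler_step k y i| <=
    (1 + 3 * X * k) * (E / N.+1%:R).
  by rewrite -euler_stepB;
    apply: (euler_step_bound hmu lambda0 (n := n)) => // j jn; exact: remy.
rewrite distrC in s4.
have E4 : Rem (t + k) i - euler_step k (Rem t) i =
  (Rem (t + k) i - slot_step i k (b i) i) +
  (slot_step i k (b i) i - slot_step i k y i) +
  (slot_step i k y i - euler_step k y i) +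
  (euler_step k y i - euler_step k (Rem t) i) by ring.
rewrite E4; apply: le_trans (ler_normD _ _) _.
apply: le_trans (lerD (ler_normD _ _) (lexx _)) _.
apply: le_trans (lerD (lerD (ler_normD _ _) (lexx _)) (lexx _)) _.
apply: le_trans (lerD (lerD (lerD s1 s2) s3) s4) _.
by rewrite le_eqVlt; apply/orP; left; apply/eqP; rewrite /E; field.
Qed.

End error.
End grid.

(** * The differential equations *)

Section derivative.
Context {R : realType} {mu : probability nat R} {m : nat}.
Hypothesis hmu : mu [set k | (1 <= k <= m)%N] = 1%E.
Variable lambda : R.
Hypothesis lambda_gt0 : 0 < lambda.
Variable M : forall n, packing_model mu lambda n.
Local Notation Rem := (mean_remaining M).

(** The forward estimate also bounds the increments of the expected numbers of
    remaining packages linearly, so that their drift is Lipschitz continuous. *)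
Lemma expected_remaining_derivative n t : 0 <= t ->
  time_derivative (fun s => Rem s n) t (lambda * drift mu (Rem t) n).
Proof.
move=> t0; pose X := n%:R * lambda; have l0 := ltW lambda_gt0.
have X0 : 0 <= X by rewrite mulr_ge0.
pose C := n%:R * X ^+ 2 * (1 + 4 * expR (3 * X * t)).
have C0 : 0 <= C.
  by rewrite /C mulr_ge0 ?addr_ge0 ?mulr_ge0 ?sqr_ge0 ?expR_ge0.
have Rem_le s i : (i <= n)%N -> `|Rem s i| <= n%:R.
  move=> iN; have /andP[r0 ri] := expected_remaining_bound (M i) s.
  by rewrite ger0_norm // (le_trans ri) // ler_nat.
have step s k i : 0 <= s <= t -> 0 < k -> (i <= n)%N ->
    `|Rem (s + k) i - Rem s i - k * (lambda * drift mu (Rem s) i)| <= C * k ^+ 2.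
  move=> /andP[s0 st] k0 iN.
  have := expected_remaining_step hmu lambda_gt0 M s0 k0 iN.
  have -> : k * (lambda * drift mu (Rem s) i) = lambda * k * drift mu (Rem s) i by ring.
  rewrite /euler_step opprD addrA => /le_trans; apply.
  rewrite ler_wpM2r ?sqr_ge0 // ler_wpM2l ?mulr_ge0 ?sqr_ge0 //.
  by rewrite lerD2l ler_wpM2l // ler_expR ler_wpM2l // mulr_ge0.
pose L := 3 * X * n%:R + C * t.
have L0 : 0 <= L by rewrite addr_ge0 // !mulr_ge0.
have lip s i : 0 <= s <= t -> (i <= n)%N -> `|Rem t i - Rem s i| <= L * (t - s).
  move=> /andP[s0 st] iN; move: (st); rewrite le_eqVlt => /predU1P[->|slt].
    by rewrite !subrr normr0 mulr0.
  have k0 : 0 < t - s by rewrite subr_gt0.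
  have := step s _ i _ k0 iN; rewrite s0 st subrKC => /(_ isT) h1.
  have h2 := lambda_drift_bound hmu l0 (ltW k0) iN (Rem_le s).
  rewrite -[_ - _](subrK ((t - s) * (lambda * drift mu (Rem s) i))).
  apply: le_trans (ler_normD _ _) _.
  have E : (t - s) * (lambda * drift mu (Rem s) i) =
      lambda * (t - s) * drift mu (Rem s) i by ring.
  rewrite -E in h2; apply: le_trans (lerD h1 h2) _.
  have kt : t - s <= t by lra.
  have := ler_wpM2l (mulr_ge0 C0 (ltW k0)) kt.
  rewrite -/X /L !expr2; lra.
apply: (@time_derivative_of_quadratic_error _ _ (fun s => lambda * drift mu (Rem s) n)
  t C (lambda * (3 * n%:R * L))) => //.
- by rewrite !mulr_ge0.
- by move=> s k st k0; exact: step.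
- move=> s /[dup] /andP[s0 st] sst.
  rewrite -mulrBr normrM (ger0_norm l0) -mulrA ler_wpM2l //.
  have -> : drift mu (Rem s) n - drift mu (Rem t) n =
      drift mu (fun j => 1 * Rem s j + (-1) * Rem t j) n.
    by rewrite drift_comb; ring.
  rewrite -[leRHS]mulrA; apply: (drift_bound hmu) => j jn.
  by rewrite mul1r mulN1r distrC; exact: lip sst jn.
Qed.

End derivative.

Theorem theorem3p1 (R : realType) (m : nat) (hm : (0 < m)%N)
    (mu : probability nat R) (hmu : mu [set k | (1 <= k <= m)%N] = 1%E)
    (lambda : R) (hlambda : 0 < lambda)
    (M : forall n : nat, packing_model mu lambda n)
    (n : nat) (hn : (0 < n)%N) :
  let f := bundle_pmf mu in
  let F := bundle_cdf mu in
  let K (t : R) (i : nat) := expected_picked (M i) t in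
  let Rem (t : R) (i : nat) := expected_remaining (M i) t in
  [/\ forall t : R, 0 <= t ->
        exists2 dK : R, time_derivative (fun s => K s n) t dK &
          lambda^-1 * dK =
            - (\sum_(1 <= j < n.+1) F j) * K t n
            + 2 * \sum_(1 <= i < n) F (n - i)%N * K t i
            + \sum_(1 <= i < n.+1) f i * i%:R * (n + 1 - i)%:R,
      K 0 n = 0,
      forall t : R, 0 <= t ->
        exists2 dR : R, time_derivative (fun s => Rem s n) t dR &
          lambda^-1 * dR =
            - (\sum_(1 <= i < n.+1) F i) * Rem t n
            + 2 * \sum_(1 <= i < n) F (n - i)%N * Rem t i
    & Rem 0 n = n%:R].
Proof.
move=> f F K Rem.
have Rem0 : Rem 0 n = n%:R by exact: (expected_remaining0 hmu hlambda M n).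
have KE s i : K s i = i%:R - Rem s i by rewrite /Rem /expected_remaining subKr.
have dRem t : 0 <= t ->
    time_derivative (fun s => Rem s n) t (lambda * drift mu (Rem t) n).
  by move=> t0; exact: (expected_remaining_derivative hmu hlambda (M := M) (n := n) t0).
have lambda_neq0 : lambda != 0 by rewrite gt_eqF.
split => // [t t0||t t0].
- exists (- (lambda * drift mu (Rem t) n)).
    have := dRem t t0; rewrite /time_derivative => /cvgN; apply: cvg_trans.
    apply: near_eq_cvg; near=> h; rewrite !KE /=; rewrite fctE; ring.
  rewrite mulrN mulKf // -[X in _ + X]opprK -(drift_id hmu).
  rewrite -/(drift mu (K t) n).
  have -> : drift mu (K t) n =
      1 * drift mu (fun i => i%:R) n + (-1) * drift mu (Rem t) n.
    by rewrite -drift_comb; apply: drift_ext => i _; rewrite KE; ring.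
  by ring.
- by rewrite KE Rem0 subrr.
- by exists (lambda * drift mu (Rem t) n); [exact: dRem|rewrite mulKf].
Unshelve. all: by end_near.
Qed.
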